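(* Let $n\ge 6$ be an integer. Then $$\begin{aligned}S^2([n-3,3])=\;&[n]+\delta_{n\ge 7}[n-1,1]+(1+\delta_{n\ge 8})[n-2,2]+(\delta_{n\ge 7}+\delta_{n\ge 9})[n-3,3]\\&+\delta_{n\ge 7}[n-3,2,1]+(\delta_{n\ge 8}+\delta_{n\ge 10})[n-4,4]+\delta_{n\ge 8}[n-4,3,1]\\&+(1+\delta_{n\ge 8})[n-4,2^2]+\delta_{n\ge 11}[n-5,5]+\delta_{n\ge 9}[n-5,4,1]\\&+\delta_{n\ge 9}[n-5,3,2]+\delta_{n\ge 7}[n-5,2^2,1]+\delta_{n\ge 12}[n-6,6]+\delta_{n\ge 10}[n-6,4,2]\end{aligned}$$ and $$\begin{aligned}A^2([n-3,3])=\;&\delta_{n\ge 7}[n-2,1^2]+\delta_{n\ge 8}[n-3,2,1]+[n-3,1^3]+(\delta_{n\ge 7}+\delta_{n\ge 9})[n-4,3,1]\\&+\delta_{n\ge 7}[n-4,2,1^2]+\delta_{n\ge 10}[n-5,4,1]+\delta_{n\ge 8}[n-5,3,2]\\&+\delta_{n\ge 8}[n-5,3,1^2]+\delta_{n\ge 11}[n-6,5,1]+\delta_{n\ge 9}[n-6,3^2].\end{aligned}$$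
   Context: For a partition $\lambda$ of $n$, $[\lambda]$ denotes the irreducible complex character of the symmetric group $S_n$ labelled by $\lambda$. For a character $\chi$ of a finite group, $S^2(\chi)(g)=\tfrac12(\chi(g)^2+\chi(g^2))$ and $A^2(\chi)(g)=\tfrac12(\chi(g)^2-\chi(g^2))$. The symbol $\delta_{n\ge m}$ equals $1$ if $n\ge m$ and $0$ if $n<m$; a term with coefficient $0$ is omitted (even if its label is not a partition). *)

(* Defs.v *)
From HB Require Import structures.
From mathcomp Require Import all_boot all_order all_fingroup all_algebra.
From mathcomp Require Import all_solvable all_field all_character.

Set Implicit Arguments.
Unset Strict Implicit.
Unset Printing Implicit Defensive.
Import GroupScope GRing.Theory.
Local Open Scope ring_scope.

Section Squares.

Variables (gT : finGroupType) (G : {group gT}).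

(* The factors (x \in G) only make the functions vanish off G: the square of
   an element outside G may lie in G. *)

Fact cfS2_subproof (chi : 'CF(G)) :
  is_class_fun <<G>>
    [ffun x => (chi x ^+ 2 + chi (x ^+ 2)%g) / 2%:R *+ (x \in G)].
Proof.
rewrite genGid; apply: intro_class_fun => [x y Gx Gy | x /negPf-> //].
by rewrite -conjXg !cfunJ // groupJr.
Qed.
Definition cfS2 (chi : 'CF(G)) : 'CF(G) := Cfun 0 (cfS2_subproof chi).

Fact cfA2_subproof (chi : 'CF(G)) :
  is_class_fun <<G>>
    [ffun x => (chi x ^+ 2 - chi (x ^+ 2)%g) / 2%:R *+ (x \in G)].
Proof.
rewrite genGid; apply: intro_class_fun => [x y Gx Gy | x /negPf-> //].
by rewrite -conjXg !cfunJ // groupJr.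
Qed.
Definition cfA2 (chi : 'CF(G)) : 'CF(G) := Cfun 0 (cfA2_subproof chi).

End Squares.

Section SymmetricGroupCharacters.

Variable n : nat.

Fact cfSign_subproof (H : {group 'S_n}) :
  is_class_fun <<H>> [ffun s : 'S_n => (-1) ^+ odd_perm s *+ (s \in H)].
Proof.
rewrite genGid; apply: intro_class_fun => [x y Hx Hy | x /negPf-> //].
by rewrite odd_permJ groupJr.
Qed.
Definition cfSign (H : {group 'S_n}) : 'CF(H) := Cfun 0 (cfSign_subproof H).

(* The permutations of {0, ..., n-1} that preserve the fibres of f. *)
Definition fibre_stab (f : nat -> nat) : {set 'S_n} :=
  [set s : 'S_n | [forall i : 'I_n, f (s i) == f i]].

Fact fibre_stab_group_set f : group_set (fibre_stab f).
Proof.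
apply/group_setP; split=> [|s t].
  by rewrite inE; apply/forallP=> i; rewrite perm1.
rewrite !inE => /forallP fs /forallP ft; apply/forallP=> i.
by rewrite permM (eqP (ft _)) fs.
Qed.
Canonical fibre_stab_group f := Group (fibre_stab_group_set f).

(* Fill the diagram of la with 0, 1, ..., n-1, row after row. The entry i is in
   row reshape_index la i and in column reshape_offset la i, so these are the
   row and the column stabiliser of that tableau: Young subgroups of types la
   and la', where la' is the conjugate partition. *)
Definition row_stab (la : seq nat) : {group 'S_n} :=
  fibre_stab_group (reshape_index la).
Definition col_stab (la : seq nat) : {group 'S_n} :=
  fibre_stab_group (reshape_offset la).

(* The irreducible character [la] of S_n labelled by the partition la of n, as
   in James and Kerber, The Representation Theory of the Symmetric Group: the
   unique irreducible constituent common to the character induced from the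
   trivial character of a Young subgroup of type la and the one induced from
   the sign character of a Young subgroup of type la'. So [(n)] is the trivial
   and [(1^n)] the sign character. The value is meaningful only when la is a
   partition of n, without null parts; the branch 0 is then not reached. *)
Definition irrS (la : seq nat) : 'CF([set: 'S_n]) :=
  if [pick i in irr_constt ('Ind[[set: 'S_n], row_stab la] 1)
        | i \in irr_constt ('Ind[[set: 'S_n], col_stab la]
                              (cfSign (col_stab la)))]
  is Some i then 'chi_i else 0.

End SymmetricGroupCharacters.

Definition delta_ge (n m : nat) : nat := (m <= n)%N.

(* Main.v *)
Require Import Defs.
From HB Require Import structures.
From mathcomp Require Import all_boot all_order all_fingroup all_algebra.
From mathcomp Require Import all_solvable all_field all_character.
From mathcomp Require Import zify ring lra.

Set Implicit Arguments.
Unset Strict Implicit.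
Unset Printing Implicit Defensive.
Import GroupScope Order.TTheory GRing.Theory Num.Theory.
Local Open Scope ring_scope.

(** Everything is reduced to Young permutation characters. For a composition a
    of n let M(a) be the permutation character of S_n on the colourings of n
    points that use colour i exactly a_i times (cfColour).

    Every irreducible character is a determinant of such characters: [lam] is
    the sum over permutations w of sgn w * M(lam_i - i + w_i), the Jacobi-Trudi
    formula irrS_cfDet. The product of M(a) and M(b) is the sum of the M(A) over
    the matrices A with margins a and b, so (M(a), M(b)) counts these matrices.
    In the scalar product of the determinant with M(b), the matrices with an
    entry below the diagonal cancel in pairs (sum_alternant_below), and the
    upper triangular ones only exist if b is dominated by lam. As all terms of
    the determinant but M(lam) are M(b) with b strictly dominating lam in some
    partial sum, the determinant has norm 1 and product 1 with M(lam): it is an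
    irreducible constituent of M(lam). The product of M(b) with the character
    induced from the sign character of the column stabiliser counts colourings
    that are injective on the columns of the tableau, up to column
    permutations. It is 0 for those b and 1 for b = lam. So the induced
    character has product 1 with M(lam) as well as with the determinant, and
    the determinant is the single constituent that it shares with M(lam).

    It remains to express chi(g)^2 and chi(g^2) for chi = [n-3,3], the
    difference of the permutation characters on 3-subsets and on 2-subsets. A
    pair of fixed subsets is classified by the size of its intersection
    (numfix_mul). A subset A fixed by g^2 is cut into its intersection J with
    gA and a set U disjoint from its image gU. The number of such U with given
    union Y of U and gU is the sum of (-1)^|I| over the g-invariant subsets I
    of Y: both are the number of ways to alternate along the cycles in Y if all
    of these are even, and 0 otherwise (sum_sign_on). Hence chi(g^2) is an
    alternating sum of Young permutation characters (numfix_sqr).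

    Both identities are now linear relations between the M(a), where M(a) does
    not depend on the order of the parts of a and on its zeros. They are checked by computing
    coefficients, once with symbolic n for all n >= 12 and once for each n from
    6 to 11, where the multiplicities still vary. *)

(** * Permutation characters on colourings *)

Section Colourings.

Variable n : nat.

Definition fibre_card (C : finType) (f : {ffun 'I_n -> C}) (c : C) : nat :=
  #|[set x | f x == c]|.

Definition has_content (C : finType) (a : C -> int) (f : {ffun 'I_n -> C}) :=
  [forall c, (fibre_card f c)%:Z == a c].

Definition invariant (C : finType) (g : 'S_n) (f : {ffun 'I_n -> C}) :=
  [forall x, f (g x) == f x].

Definition pullback (C : finType) (y : 'S_n) (f : {ffun 'I_n -> C}) :=
  [ffun x => f (y x)].

Lemma has_contentP (C : finType) (a : C -> int) (f : {ffun 'I_n -> C}) :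
  reflect (forall c, (fibre_card f c)%:Z = a c) (has_content a f).
Proof. by apply: (iffP forallP) => H c; apply/eqP. Qed.

Lemma invariantP (C : finType) (g : 'S_n) (f : {ffun 'I_n -> C}) :
  reflect (forall x, f (g x) = f x) (invariant g f).
Proof. by apply: (iffP forallP) => H c; apply/eqP. Qed.

Lemma sum_fibre_card (C : finType) (f : {ffun 'I_n -> C}) :
  (\sum_c fibre_card f c)%N = n.
Proof.
rewrite -[RHS]card_ord -sum1_card (partition_big f predT) //=.
by apply: eq_bigr => c _; rewrite /fibre_card -sum1_card; apply: eq_bigl => x;
  rewrite inE.
Qed.

Lemma pullbackK (C : finType) (y : 'S_n) :
  cancel (@pullback C y) (pullback y^-1).
Proof. by move=> f; apply/ffunP=> x; rewrite !ffunE permKV. Qed.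

Lemma pullbackVK (C : finType) (y : 'S_n) :
  cancel (@pullback C y^-1) (pullback y).
Proof. by move=> f; apply/ffunP=> x; rewrite !ffunE permK. Qed.

Lemma fibre_card_pullback (C : finType) (y : 'S_n) (f : {ffun 'I_n -> C}) :
  fibre_card (pullback y f) =1 fibre_card f.
Proof.
move=> c; rewrite /fibre_card -[RHS](card_preimset _ (@perm_inj _ y)).
by apply: eq_card => x; rewrite !inE ffunE.
Qed.

Lemma has_content_pullback (C : finType) (a : C -> int) y f :
  has_content a (pullback y f) = has_content a f.
Proof.
by apply/has_contentP/has_contentP => H c; rewrite -H fibre_card_pullback.
Qed.

Lemma invariant_pullback (C : finType) (g y : 'S_n) (f : {ffun 'I_n -> C}) :
  invariant g (pullback y f) = invariant (g ^ y) f.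
Proof.
apply/invariantP/invariantP=> H x; last first.
  by rewrite !ffunE -(H (y x)) conjgE !permM permK.
by have := H (y^-1 x)%g; rewrite !ffunE conjgE !permM permKV.
Qed.

(** Listing the values of a colouring turns this into the fact that two lists
    with the same multiplicities are permutations of each other. *)
Lemma same_content_pullback (C : finType) (f f' : {ffun 'I_n -> C}) :
  fibre_card f =1 fibre_card f' -> exists y : 'S_n, f' = pullback y f.
Proof.
move=> eff'.
have cnt (h : {ffun 'I_n -> C}) c : count_mem c (codom h) = fibre_card h c.
  rewrite /codom /image_mem count_map -sum1_count /fibre_card -sum1_card big_enum_cond.
  by apply: eq_bigl => x; rewrite inE.
have /(@tuple_permP _ n (codom f') [tuple f x | x < n]) [p Ep] :
    perm_eq (codom f') [tuple f x | x < n].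
  have -> : tval [tuple f x | x < n] = codom f by [].
  by apply/allP=> c _ /=; rewrite !cnt eff'.
exists p; apply/ffunP=> x; rewrite ffunE.
have := congr1 (fun s => nth (f x) s x) Ep.
by rewrite -tnth_nth !tnth_mktuple codomE (nth_map x) ?size_enum_ord // nth_ord_enum.
Qed.

Definition numfix (C : finType) (a : C -> int) (g : 'S_n) : nat :=
  #|[set f : {ffun 'I_n -> C} | has_content a f && invariant g f]|.

Lemma numfixJ (C : finType) (a : C -> int) g y : numfix a (g ^ y) = numfix a g.
Proof.
rewrite /numfix -(card_imset _ (can_inj (@pullbackK C y))).
apply: eq_card => f; rewrite !inE; apply/imsetP/andP => [[f' + ->]|[H1 H2]].
  by rewrite inE has_content_pullback invariant_pullback => /andP[].
exists (pullback y^-1 f); last by rewrite pullbackVK.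
by rewrite inE -invariant_pullback has_content_pullback pullbackVK H1.
Qed.

Fact cfColour_subproof (C : finType) (a : C -> int) :
  is_class_fun <<[set: 'S_n]>> [ffun g => (numfix a g)%:R].
Proof.
rewrite genGid; apply: intro_class_fun => [x y _ _ | x]; last by rewrite inE.
by rewrite numfixJ.
Qed.
(** The permutation character of S_n on the colourings of content a; for a
    colour set 'I_r this is the Young permutation character of the composition
    a. Contents are integers, so that the character of a sequence with a
    negative entry, as it occurs in determinants, is 0. *)
Definition cfColour (C : finType) (a : C -> int) : 'CF([set: 'S_n]) :=
  Cfun 0 (cfColour_subproof a).

Lemma cfColourE (C : finType) (a : C -> int) g : cfColour a g = (numfix a g)%:R.
Proof. exact: cfunElock. Qed.

Lemma eq_cfColour (C : finType) (a b : C -> int) :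
  a =1 b -> cfColour a = cfColour b.
Proof.
move=> eab; apply/cfunP=> g; rewrite !cfColourE; congr _%:R.
by apply: eq_card => f; rewrite !inE; congr andb;
  apply/has_contentP/has_contentP => H c; rewrite H eab.
Qed.

(** Renaming colours: this covers permutations of a content and the deletion
    of colours that are used zero times. *)
Lemma cfColour_rename (C C' : finType) (h : C -> C') (a : C -> int) (a' : C' -> int) :
  injective h -> (forall c, a' (h c) = a c) ->
  (forall c', c' \notin codom h -> a' c' = 0) ->
  cfColour a = cfColour a'.
Proof.
move=> hI aE a0; apply/cfunP=> g; rewrite !cfColourE; congr _%:R.
pose H (f : {ffun 'I_n -> C}) := [ffun x => h (f x)].
have HI : injective H.
  by move=> f1 f2 /ffunP E; apply/ffunP=> x; have := E x; rewrite !ffunE => /hI.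
rewrite /numfix -(card_imset _ HI); apply: eq_card => f'; rewrite inE.
have fcH f c : fibre_card (H f) (h c) = fibre_card f c.
  by apply: eq_card => x; rewrite !inE ffunE (inj_eq hI).
apply/imsetP/andP => [[f + ->]|[/has_contentP Hc /invariantP Hi]].
  rewrite inE => /andP[/has_contentP Hc /invariantP Hi]; split; last first.
    by apply/invariantP=> x; rewrite !ffunE Hi.
  apply/has_contentP=> c'; have [/codomP[c ->]|nc'] := boolP (c' \in codom h).
    by rewrite aE fcH Hc.
  rewrite a0 //; apply/eqP; rewrite eqz_nat cards_eq0; apply/eqP/setP=> x.
  by rewrite !inE ffunE; apply/eqP=> E; rewrite -E codom_f in nc'.
have f'h x : f' x \in codom h.
  apply/negPn/negP=> /a0/eqP; rewrite -Hc eqz_nat cards_eq0 => /eqP/setP/(_ x).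
  by rewrite !inE eqxx.
have Ef : f' = H [ffun x => iinv (f'h x)].
  by apply/ffunP=> x; rewrite !ffunE f_iinv.
exists [ffun x => iinv (f'h x)]; rewrite ?Ef // inE; apply/andP; split.
  by apply/has_contentP=> c; rewrite -fcH -Ef Hc aE.
by apply/invariantP=> x; apply: hI; rewrite !ffunE !f_iinv.
Qed.

(** At g the induced character counts the y such that g fixes pullback y f,
    divided by the order of the stabiliser of f. As S_n is transitive on the
    colourings of content a, each of them is pullback y f for exactly that many
    y. *)
Lemma Ind1_fibre_stab (C : finType) (phi : nat -> nat) (f : {ffun 'I_n -> C}) a :
  (forall x y : 'I_n, (phi x == phi y) = (f x == f y)) -> has_content a f ->
  'Ind[[set: 'S_n], fibre_stab_group n phi] 1 = cfColour a.
Proof.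
move=> phiE fa; apply/cfunP=> g; rewrite cfColourE cfIndE ?subsetT //.
set H := fibre_stab_group n phi.
have inH y : (y \in H) = invariant y f.
  by rewrite inE; apply: eq_forallb => x; rewrite phiE.
under eq_bigr do rewrite cfun1E inH -invariant_pullback.
rewrite -natr_sum.
suff -> : (\sum_(y in [set: 'S_n]) invariant g (pullback y f) = #|H| * numfix a g)%N.
  by rewrite natrM mulKf // pnatr_eq0 -lt0n cardG_gt0.
rewrite (partition_big (fun y => pullback y f) (has_content a)) /=; last first.
  by move=> y _; rewrite has_content_pullback.
rewrite /numfix -sum1_card big_distrr /= big_mkcond [RHS]big_mkcond.
apply: eq_bigr => f' _; rewrite inE; case: ifP => //= f'a.
have [y Ef'] : exists y, f' = pullback y f.
  by apply: same_content_pullback => c; apply/eqP;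
    rewrite -eqz_nat (has_contentP _ _ fa) (has_contentP _ _ f'a).
rewrite (eq_bigr (fun=> invariant g f' : nat)) => [|z /andP[_ /eqP->] //].
case: (invariant g f'); last by rewrite big1.
rewrite muln1 sum1_card -(card_lcoset _ y).
apply: eq_card => z; rewrite mem_lcoset inH [LHS]inE inE Ef' /=.
apply/eqP/invariantP=> [/ffunP E x|E].
  by have := E (y^-1 x)%g; rewrite !ffunE permM permKV.
by apply/ffunP=> x; rewrite !ffunE -(E (y x)) permM permK.
Qed.

Lemma cfColour_Ind1 (C : finType) (a : C -> int) f :
  has_content a f -> exists H : {group 'S_n}, cfColour a = 'Ind[[set: 'S_n], H] 1.
Proof.
move=> fa.
pose phi k := if insub k is Some x then enum_rank (f x) : nat else 0%N.
exists (fibre_stab_group n phi); rewrite (@Ind1_fibre_stab _ _ f a) // => x y.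
by rewrite /phi !valK; rewrite (inj_eq val_inj) (inj_eq enum_rank_inj).
Qed.

Lemma cfColour_eq0 (C : finType) (a : C -> int) :
  (forall f : {ffun 'I_n -> C}, ~~ has_content a f) -> cfColour a = 0.
Proof.
move=> no; apply/cfunP=> g; rewrite cfColourE cfunE; apply/eqP.
rewrite pnatr_eq0 cards_eq0; apply/eqP/setP=> f.
by rewrite !inE (negPf (no f)).
Qed.

Lemma cfColour_char (C : finType) (a : C -> int) : cfColour a \is a character.
Proof.
have [/existsP[f fa]|] := boolP [exists f : {ffun 'I_n -> C}, has_content a f].
  by have [H ->] := cfColour_Ind1 fa; rewrite cfInd_char ?cfun1_char.
rewrite negb_exists => /forallP no.
by rewrite cfColour_eq0 ?cfun0_char.
Qed.

(** A colouring with given fibre sizes is a list with given multiplicities. *)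
Lemma exists_content (C : finType) (a : C -> nat) :
  (\sum_c a c)%N = n -> exists f, has_content (fun c => (a c)%:Z) f.
Proof.
move=> sa; pose s := flatten [seq nseq (a c) c | c <- enum C].
have ss : size s == n.
  rewrite size_flatten /shape -map_comp sumnE big_map big_enum /= -[X in _ == X]sa.
  by apply/eqP/eq_bigr => c _; rewrite size_nseq.
exists [ffun x => tnth (Tuple ss) x]; apply/has_contentP => c; congr _%:Z.
have <- : count_mem c s = a c.
  rewrite count_flatten -map_comp sumnE big_map big_enum /= (bigD1 c) //=.
  rewrite count_nseq /= eqxx mul1n big1 ?addn0 // => d /negPf dc.
  by rewrite count_nseq /= dc.
rewrite -[s in RHS](map_tnth_enum (Tuple ss)) count_map -sum1_count big_enum_cond.
by rewrite /fibre_card -sum1_card; apply: eq_bigl => x; rewrite inE ffunE.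
Qed.

(** By Frobenius reciprocity, as the action is transitive. *)
Lemma cfdot_cfColour1 (C : finType) (a : C -> nat) :
  (\sum_c a c)%N = n -> '[cfColour (fun c => (a c)%:Z), 1] = 1.
Proof.
move=> sa; have [f fa] := exists_content sa; have [H ->] := cfColour_Ind1 fa.
by rewrite -Frobenius_reciprocity cfRes_cfun1 ?subsetT // cfnorm1.
Qed.

End Colourings.

(** * Products of permutation characters *)

Section InnerProducts.

Variable n : nat.

(** The bound n on the entries is harmless, as n points are coloured; it keeps
    the set of matrices finite. *)
Definition has_margins (C C' : finType) (a : C -> int) (b : C' -> int)
    (A : {ffun C * C' -> 'I_n.+1}) :=
  [forall c, (\sum_c' A (c, c'))%N%:Z == a c] &&
  [forall c', (\sum_c A (c, c'))%N%:Z == b c'].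

(** A pair of colourings is a colouring by pairs, and the contents of the two
    components are the margins of its content. *)
Lemma cfColourM (C C' : finType) (a : C -> int) (b : C' -> int) :
  cfColour n a * cfColour n b =
  \sum_(A | has_margins a b A) cfColour n (fun p => (A p : nat)%:Z).
Proof.
apply/cfunP=> g; rewrite cfunE sum_cfunE !cfColourE.
under eq_bigr do rewrite cfColourE.
rewrite -natr_sum -natrM; congr _%:R.
pose fs (h : {ffun 'I_n -> C * C'}) := [ffun x => (h x).1].
pose sn (h : {ffun 'I_n -> C * C'}) := [ffun x => (h x).2].
have invh h : invariant g h = invariant g (fs h) && invariant g (sn h).
  apply/invariantP/andP => [H|[/invariantP H1 /invariantP H2] x].
    by split; apply/invariantP=> x; rewrite !ffunE H.
  by have:= H1 x; have:= H2 x; rewrite !ffunE;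
    case: (h _) (h _) => [? ?] [? ?] /= -> ->.
have Efs h c : (\sum_c' fibre_card h (c, c') = fibre_card (fs h) c)%N.
  rewrite /fibre_card -sum1_card (partition_big (fun x => (h x).2) predT) //=.
  apply: eq_bigr => c' _; rewrite -sum1_card; apply: eq_bigl => x.
  by rewrite !inE ffunE; case: (h x).
have Esn h c' : (\sum_c fibre_card h (c, c') = fibre_card (sn h) c')%N.
  rewrite /fibre_card -sum1_card (partition_big (fun x => (h x).1) predT) //=.
  apply: eq_bigr => c _; rewrite -sum1_card; apply: eq_bigl => x.
  by rewrite !inE ffunE; case: (h x) => ? ? /=; rewrite xpair_eqE andbC.
pose P h := has_content a (fs h) && has_content b (sn h).
transitivity (\sum_(h | P h && invariant g h) 1)%N.
  rewrite /numfix -cardsX sum1_card.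
  pose pr (h : {ffun 'I_n -> C * C'}) := (fs h, sn h).
  have prI : injective pr.
    move=> h1 h2 [/ffunP E1 /ffunP E2]; apply/ffunP=> x.
    by have:= E1 x; have:= E2 x; rewrite !ffunE;
      case: (h1 _) (h2 _) => [? ?] [? ?] /= -> ->.
  rewrite -(card_imset _ prI); apply: eq_card => -[f f']; rewrite !inE /=.
  apply/idP/imsetP => [H|[h + [-> ->]]]; last first.
    by rewrite unfold_in /= /P invh; case/andP=> /andP[-> ->] /andP[-> ->].
  have [E1 E2] : fs [ffun x => (f x, f' x)] = f /\ sn [ffun x => (f x, f' x)] = f'.
    by split; apply/ffunP=> x; rewrite !ffunE.
  exists [ffun x => (f x, f' x)]; last by rewrite /pr E1 E2.
  by rewrite unfold_in /= /P invh E1 E2; case/andP: H => /andP[-> ->] /andP[-> ->].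
have fb h p : (@fibre_card n _ h p < n.+1)%N.
  by rewrite ltnS -[X in (_ <= X)%N]card_ord max_card.
pose ct (h : {ffun 'I_n -> C * C'}) := [ffun p => inord (fibre_card h p) : 'I_n.+1].
have ctE h p : ct h p = fibre_card h p :> nat by rewrite ffunE inordK.
have ctP h A : (ct h == A) = has_content (fun p => (A p : nat)%:Z) h.
  apply/eqP/has_contentP => [<- p|H]; first by rewrite ctE.
  by apply/ffunP=> p; apply: val_inj; rewrite /= ctE; have [] := H p.
have ctm h : P h = has_margins a b (ct h).
  rewrite /P /has_margins; congr andb; apply: eq_forallb => c; congr (_%:Z == _).
    by rewrite -Efs; apply: eq_bigr => c' _; rewrite ctE.
  by rewrite -Esn; apply: eq_bigr => c' _; rewrite ctE.
rewrite (partition_big ct (has_margins a b)) /=; last first.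
  by move=> h /andP[]; rewrite ctm.
apply: eq_bigr => A mA; rewrite sum1_card; apply: eq_card => h; rewrite inE.
rewrite unfold_in /= ctm -ctP andbC; case: eqP => //= ->.
by rewrite mA.
Qed.

(** The product of two real characters pairs with the trivial character as the
    characters pair with each other, and each cfColour n A contributes 1. *)
Lemma cfdot_cfColour (C C' : finType) (a : C -> int) (b : C' -> int) :
  \sum_c b c = n%:Z ->
  '[cfColour n a, cfColour n b] = #|[set A | has_margins a b A]|%:R.
Proof.
move=> sb.
have -> : '[cfColour n a, cfColour n b] = '[cfColour n a * cfColour n b, 1].
  rewrite !cfdotE; congr (_ * _); apply: eq_bigr => g _.
  by rewrite cfun1E inE !rmorph_nat mulr1 [RHS]cfunE !cfColourE rmorph_nat.
rewrite cfColourM cfdot_suml (eq_bigr (fun=> 1)) => [|A /andP[_ /forallP H2]].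
  by rewrite sumr_const; congr (_ *+ _); apply: eq_card => A; rewrite inE.
apply: cfdot_cfColour1; apply/eqP; rewrite -eqz_nat -sb; apply/eqP.
have -> : (\sum_p A p = \sum_c \sum_c' A (c, c'))%N.
  by rewrite pair_bigA; apply: eq_bigr => -[c c'].
rewrite exchange_big /= (big_morph Posz PoszD (erefl _)).
by apply: eq_bigr => c _; apply/eqP.
Qed.

End InnerProducts.

(** The first p values of a nonincreasing function have the largest sum among
    all choices of p values. *)
Lemma sum_perm_le r (mu : 'I_r -> int) (v : 'S_r) (p : nat) :
  (forall i j : 'I_r, (i <= j)%N -> mu j <= mu i) ->
  \sum_(m < r | (m < p)%N) mu (v m) <= \sum_(m < r | (m < p)%N) mu m.
Proof.
move=> mud.
have [rp|pr] := leqP r p.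
  rewrite [X in X <= _](eq_bigl xpredT) => [|m];
    last by rewrite (leq_trans (ltn_ord m)).
  rewrite [X in _ <= X](eq_bigl xpredT) => [|m];
    last by rewrite (leq_trans (ltn_ord m)).
  by rewrite [X in _ <= X](reindex_inj (@perm_inj _ v)) lexx.
(* The threshold t separates the values at indices below p from the others. *)
pose t := mu (Ordinal pr).
rewrite -subr_ge0.
have -> : \sum_(m < r | (m < p)%N) mu m - \sum_(m < r | (m < p)%N) mu (v m)
   = \sum_(m < r | (m < p)%N) (mu m - t) - \sum_(m < r | (m < p)%N) (mu (v m) - t).
  by rewrite !sumrB; lra.
have -> : \sum_(m < r | (m < p)%N) (mu (v m) - t) =
  \sum_(m < r | ((v^-1)%g m < p)%N) (mu m - t).
  by rewrite [RHS](reindex_inj (@perm_inj _ v)); apply: eq_bigl => m; rewrite permK.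
rewrite subr_ge0 [X in X <= _]big_mkcond [X in _ <= X]big_mkcond /=.
apply: ler_sum => m _; have [mp|pm] := ltnP m p.
  by case: ifP => // _; rewrite subr_ge0 mud //= ltnW.
by case: ifP => // _; rewrite subr_le0 mud.
Qed.

(** * The determinant and a sign-reversing involution *)

Section DeterminantalCharacter.

Variable n : nat.

(** The Jacobi-Trudi determinant det (h_(lam_i - i + j)), in which a product of
    complete symmetric functions h_a is read as the Young permutation character
    of the composition a. *)
Definition cfDet r (lam : 'I_r -> int) : 'CF([set: 'S_n]) :=
  \sum_(w : 'S_r) (-1) ^+ w *: cfColour n (fun i => lam i - i%:Z + (w i)%:Z).

Section Involution.

Variable r : nat.
Implicit Types (B : {ffun 'I_r * 'I_r -> 'I_n.+1}) (v : 'S_r) (k m : 'I_r).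

(** What a matrix with shifted row sums rho contributes to the scalar product
    of cfDet with a permutation character, mu being the shifted partition: an
    alternating function of rho. *)
Definition alternant (mu rho : 'I_r -> int) : algC :=
  \sum_(v : 'S_r) (-1) ^+ v * [forall m, rho m == mu (v m)]%:R.

Definition shifted_row_sum B m : int := (\sum_k B (m, k))%N%:Z - m%:Z.

Definition has_col_sums (b : 'I_r -> int) B :=
  [forall k, (\sum_m B (m, k))%N%:Z == b k].

Definition below_diag B k m := (k < m)%N && (0 < B (m, k))%N.

(** (m, k) is the lowest nonzero entry below the diagonal in the first column
    that has one. *)
Definition first_below_diag k m B :=
  below_diag B k m &&
  [forall k2, forall m2, below_diag B k2 m2 ==>
     ((k < k2) || (k == k2) && (m2 <= m))%N].

Lemma eq_alternant mu rho rho' : rho =1 rho' -> alternant mu rho = alternant mu rho'.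
Proof.
move=> E; apply: eq_bigr => v _; congr (_ * _%:R); congr nat_of_bool.
by apply: eq_forallb => m; rewrite E.
Qed.

Lemma alternant_tperm mu rho (i j : 'I_r) : i != j ->
  alternant mu (fun m => rho (tperm i j m)) = - alternant mu rho.
Proof.
move=> ij; rewrite /alternant (reindex_inj (mulgI (tperm i j))) -sumrN.
apply: eq_bigr => v _; rewrite odd_permM odd_tperm ij signr_addb expr1 mulN1r mulNr.
congr (- (_ * _%:R)); congr nat_of_bool; apply/forallP/forallP => H m.
  by have := H (tperm i j m); rewrite permM tpermK.
by rewrite permM.
Qed.

(** Permuting the colours in the w-th term of the determinant by w moves w from
    the row index to the partition, so that the condition on the matrix no
    longer depends on w except through the shifted partition. *)
Lemma cfdot_cfDet (lam b : 'I_r -> int) : \sum_c b c = n%:Z ->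
  '[cfDet lam, cfColour n b] =
  \sum_(B | has_col_sums b B) alternant (fun i => lam i - i%:Z) (shifted_row_sum B).
Proof.
move=> sb; rewrite /cfDet cfdot_suml.
transitivity (\sum_(v : 'S_r) (-1) ^+ v * \sum_(B | has_col_sums b B)
     [forall m, shifted_row_sum B m == lam (v m) - (v m)%:Z]%:R : algC).
  rewrite [RHS](reindex_inj invg_inj); apply: eq_bigr => w _.
  rewrite cfdotZl odd_permV; congr (_ * _).
  rewrite (@cfColour_rename _ _ _ w _ (fun m =>
    lam (w^-1 m)%g - (w^-1 m)%g%:Z + m%:Z)); first last.
  - by move=> c /negP[]; rewrite -(permKV w c) codom_f.
  - by move=> c; rewrite permK.
  - exact: perm_inj.
  rewrite cfdot_cfColour // -natr_sum -sum1_card big_mkcond [in RHS]big_mkcond.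
  congr _%:R; apply: eq_bigr => B _; rewrite inE /has_margins andbC.
  rewrite -/(has_col_sums b B); case: has_col_sums => //=.
  rewrite (_ : [forall c, _] =
    [forall m, shifted_row_sum B m == lam (w^-1 m)%g - (w^-1 m)%g%:Z]);
      first by case: ifP.
  by apply: eq_forallb => m; rewrite /shifted_row_sum subr_eq.
under eq_bigr do rewrite big_distrr.
by rewrite exchange_big.
Qed.

Variables (b : 'I_r -> int) (sum_b : \sum_c b c = n%:Z).

Lemma col_sums_le B m m' k : has_col_sums b B -> m != m' ->
  (B (m, k) + B (m', k) <= n)%N.
Proof.
move=> /forallP H mm'.
have b0 c : 0 <= b c by rewrite -(eqP (H c)).
rewrite -lez_nat -sum_b (bigD1 k) //= -(eqP (H k)) (bigD1 m) //= (bigD1 m') ?[m' ==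
  m]eq_sym //=.
by rewrite addnA [X in _ <= X + _]PoszD -addrA lerDl addr_ge0 ?sumr_ge0.
Qed.

(** Exchanges rows m and m' and moves one unit of column k from row m' to row m.
    For m = m' + 1 this compensates the shift, so the shifted row sums are just
    exchanged, while the column sums stay as they are. *)
Definition swap_rows (k m m' : 'I_r) B : {ffun 'I_r * 'I_r -> 'I_n.+1} :=
  [ffun p => inord (B (tperm m m' p.1, p.2) + (p == (m, k)) - (p == (m', k)))].

Lemma swap_rowsE k m m' B p : has_col_sums b B -> m != m' -> (0 < B (m, k))%N ->
  (swap_rows k m m' B p = B (tperm m m' p.1, p.2) + (p == (m, k)) - (p == (m', k)) :>
    nat)%N.
Proof.
move=> cB mm' B0; rewrite ffunE inordK // ltnS.
case: p => i j /=; rewrite !xpair_eqE.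
have := col_sums_le k cB mm'.
case: tpermP => [->|->|/eqP/negPf im /eqP/negPf im'];
  rewrite ?eqxx ?(negPf mm') ?[m' == m]eq_sym ?(negPf mm') ?im ?im' /=.
- have [->|_] := eqVneq j k => /= H; first by rewrite subn0; lia.
  by rewrite addn0 subn0 -ltnS.
- have [->|_] := eqVneq j k => /= H; first by rewrite addn0; lia.
  by rewrite addn0 subn0 -ltnS.
by move=> _; rewrite addn0 subn0 -ltnS.
Qed.

Lemma swap_rowsZ k m m' B p : has_col_sums b B -> m != m' -> (0 < B (m, k))%N ->
  (swap_rows k m m' B p : nat)%:Z =
  (B (tperm m m' p.1, p.2) : nat)%:Z + (p == (m, k))%:Z - (p == (m', k))%:Z.
Proof.
move=> cB mm' B0; rewrite swap_rowsE //.
case: p => i j /=; rewrite !xpair_eqE.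
have [->|] := eqVneq i m'; last by rewrite /= subn0 subr0.
rewrite tpermR [m' == m]eq_sym (negPf mm') /= addn0 addr0.
by have [->|_] := eqVneq j k; rewrite /= ?subn0 ?subr0 // -subzn.
Qed.

Lemma swap_rows_col k m m' B : has_col_sums b B -> m != m' -> (0 < B (m, k))%N ->
  has_col_sums b (swap_rows k m m' B).
Proof.
move=> cB mm' B0; apply/forallP=> j.
rewrite (big_morph Posz PoszD (erefl _)).
under eq_bigr do rewrite swap_rowsZ //=.
rewrite sumrB big_split /=.
have -> : \sum_i (B (tperm m m' i, j) : nat)%:Z = \sum_i (B (i, j) : nat)%:Z.
  by rewrite [RHS](reindex_inj (@perm_inj _ (tperm m m'))).
have e (m0 : 'I_r) : \sum_i ((i, j) == (m0, k))%:Z = (j == k)%:Z.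
  rewrite (bigD1 m0) //= xpair_eqE eqxx /= big1 ?addr0 // => i /negPf im.
  by rewrite xpair_eqE im.
by rewrite !e addrK -(big_morph Posz PoszD (erefl _)); apply: (forallP cB).
Qed.

Lemma swap_rows_row k m m' B : has_col_sums b B -> m != m' -> (0 < B (m, k))%N ->
  m = m'.+1 :> nat ->
  shifted_row_sum (swap_rows k m m' B) =1 (fun i => shifted_row_sum B (tperm m m' i)).
Proof.
move=> cB mm' B0 mS i; rewrite /shifted_row_sum !(big_morph Posz PoszD (erefl _)).
under eq_bigr do rewrite swap_rowsZ //=.
rewrite sumrB big_split /=.
have e (m0 : 'I_r) : \sum_j ((i, j) == (m0, k))%:Z = (i == m0)%:Z.
  rewrite (bigD1 k) //= xpair_eqE eqxx andbT /= big1 ?addr0 // => j /negPf im.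
  by rewrite xpair_eqE im andbF.
rewrite !e -!addrA; congr (_ + _).
case: tpermP => [->|->|/eqP/negPf-> /eqP/negPf->];
  rewrite ?eqxx ?(negPf mm') ?[m' == m]eq_sym ?(negPf mm').
- by rewrite mS /=; lia.
- by rewrite mS /=; lia.
- by rewrite /=; lia.
Qed.

Lemma swap_rowsK k m m' B : has_col_sums b B -> m != m' -> (0 < B (m, k))%N ->
  swap_rows k m m' (swap_rows k m m' B) = B.
Proof.
move=> cB mm' B0; apply/ffunP=> -[i j]; apply: val_inj => /=.
have B0' : (0 < swap_rows k m m' B (m, k))%N.
  by rewrite swap_rowsE //= eqxx xpair_eqE (negPf mm') subn0 addn1.
have cB' := swap_rows_col cB mm' B0.
apply/eqP; rewrite -eqz_nat swap_rowsZ //= swap_rowsZ //= tpermK.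
rewrite !xpair_eqE; case: tpermP => [->|->|/eqP/negPf-> /eqP/negPf->];
 rewrite ?eqxx ?(negPf mm') ?[m' == m]eq_sym ?(negPf mm') /=; lia.
Qed.

Lemma first_below_diag_swap k m m' B : has_col_sums b B -> m = m'.+1 :> nat ->
  first_below_diag k m B -> first_below_diag k m (swap_rows k m m' B).
Proof.
move=> cB mS /andP[/andP[km B0] /forallP low].
have mm' : m != m' by rewrite -val_eqE /= mS; lia.
apply/andP; split.
  by rewrite /below_diag km swap_rowsE //= eqxx xpair_eqE (negPf mm') subn0 addn1.
apply/forallP=> k2; apply/forallP=> m2; apply/implyP=> /andP[k2m2].
rewrite swap_rowsE // !xpair_eqE /= => C0.
have [//|lek] := ltnP k k2.
have [ekk|nkk] /= := eqVneq k k2.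
  have [//|ltm] := leqP m2 m.
  have := forallP (low k2) m2; rewrite /below_diag k2m2 ekk ltnn eqxx /=.
  rewrite [(m2 <= m)%N]leqNgt ltm implybF -eqn0Ngt => /eqP B2.
  have n1 : (m2 == m) = false by rewrite -val_eqE /=; lia.
  have n2 : (m2 == m') = false by rewrite -val_eqE /=; lia.
  by rewrite tpermD ?B2 ?n1 ?n2 ?[_ == m2]eq_sym ?n1 ?n2 in C0.
rewrite [k2 == k]eq_sym (negPf nkk) !andbF addn0 subn0 in C0.
have := forallP (low k2) (tperm m m' m2); rewrite /below_diag C0 andbT.
rewrite (negPf nkk) [(k < k2)%N]ltnNge lek /= implybF.
have k2k : (k2 < k)%N by rewrite ltn_neqAle lek andbT eq_sym; exact: nkk.
by case: tpermP k2m2 => [->|->|_ _]; lia.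
Qed.

Lemma first_below_diag_ex B : [exists k, exists m, below_diag B k m] ->
  exists k m, first_below_diag k m B.
Proof.
move=> /existsP[k0 Hk0].
case: (@arg_minnP _ k0 (fun k => [exists m, below_diag B k m]) (fun k => k) Hk0) =>
  k /existsP[m0 Hm0] mink.
case: (@arg_maxnP _ m0 (below_diag B k) (fun m => m) Hm0) => m Hm maxm.
exists k, m; rewrite /first_below_diag Hm /=.
apply/forallP=> k2; apply/forallP=> m2; apply/implyP=> H2.
have := mink k2 (introT existsP (ex_intro _ m2 H2)) => /=.
rewrite leq_eqVlt => /orP[/eqP/val_inj ek|->//].
by rewrite -ek ltnn eqxx /=; apply: maxm; rewrite ek.
Qed.

Lemma first_below_diag_uniq B k m k2 m2 :
  first_below_diag k m B -> first_below_diag k2 m2 B -> (k, m) = (k2, m2).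
Proof.
move=> /andP[H1 /forallP L1] /andP[H2 /forallP L2].
have := forallP (L1 k2) m2; have := forallP (L2 k) m;
  rewrite H1 H2 /= -!val_eqE /= => A1 A2.
by congr pair; apply: val_inj => /=; lia.
Qed.

(** A sign-reversing involution: swapping the row of the first entry below the
    diagonal with the row above it keeps the position of that entry and
    exchanges two arguments of an alternating function. In terms of
    determinants, this is the column operation that subtracts from each column
    the shifted preceding one. *)
Lemma sum_alternant_below mu :
  \sum_(B | has_col_sums b B && [exists k, exists m, below_diag B k m])
     alternant mu (shifted_row_sum B) = 0.
Proof.
pose code B := [pick p | first_below_diag p.1 p.2 B].
rewrite (partition_big code predT) //= big1 // => -[[k m]|] _; last first.
  rewrite big1 // => B /andP[/andP[_ /first_below_diag_ex[k [m kmB]]]].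
  by rewrite /code; case: pickP => // /(_ (k, m)); rewrite kmB.
have codeP B : has_col_sums b B && [exists k, exists m, below_diag B k m] &&
  (code B == Some (k, m))
     = has_col_sums b B && first_below_diag k m B.
  rewrite -andbA; congr andb; apply/andP/idP => [[_]|H]; last split.
  - by rewrite /code; case: pickP => // -[k2 m2] H /eqP[<- <-].
  - by apply/existsP; exists k; apply/existsP; exists m; case/andP: H.
  rewrite /code; case: pickP => [[k2 m2] H2|/(_ (k, m))]; last by rewrite H.
  by rewrite (first_below_diag_uniq H H2).
rewrite (eq_bigl _ _ codeP).
have [km|mk] := ltnP k m; last first.
  by rewrite big1 // => B /andP[_ /andP[/andP[]]]; rewrite ltnNge mk.
have m'P : (m.-1 < r)%N by have := ltn_ord m; lia.
pose m' := Ordinal m'P.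
have mS : m = m'.+1 :> nat by rewrite /=; lia.
have mm' : m != m' by rewrite -val_eqE /=; lia.
set S := bigop _ _ _; suff: S = - S.
  by move/eqP; rewrite -addr_eq0 -mulr2n mulrn_eq0 /= => /eqP.
rewrite {1}/S (reindex_onto (swap_rows k m m') (swap_rows k m m')) /=; last first.
  by move=> B /andP[cB /andP[/andP[_ B0] _]]; rewrite swap_rowsK.
rewrite -sumrN; apply: eq_big => [B|B].
  apply/andP/andP => [[/andP[cB fB] /eqP E]|[cB fB]].
    have B0 : (0 < swap_rows k m m' B (m, k))%N by case/andP: fB => /andP[].
    by rewrite -E swap_rows_col // first_below_diag_swap.
  have B0 : (0 < B (m, k))%N by case/andP: fB => /andP[].
  by rewrite swap_rows_col // first_below_diag_swap // swap_rowsK.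
move=> /andP[/andP[cB fB] /eqP E].
have B0' : (0 < swap_rows k m m' B (m, k))%N by case/andP: fB => /andP[].
have cB' := swap_rows_col cB mm' B0'; rewrite E in cB'.
have := first_below_diag_swap cB mS fB; rewrite E => /andP[/andP[_ B0] _].
by rewrite (eq_alternant _ (swap_rows_row cB' mm' B0 mS)) alternant_tperm.
Qed.

End Involution.

End DeterminantalCharacter.

(** * The determinant is an irreducible character *)

Section DeterminantNorm.

Variables (n r : nat) (lam : 'I_r -> nat).
Hypothesis lam_mono : forall i j : 'I_r, (i <= j)%N -> (lam j <= lam i)%N.
Hypothesis sum_lam : (\sum_i lam i)%N = n.

Let mu (i : 'I_r) : int := (lam i)%:Z - i%:Z.

Lemma shifted_part_anti (i j : 'I_r) : (i <= j)%N -> mu j <= mu i.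
Proof. by move=> ij; have := lam_mono ij; rewrite /mu; lia. Qed.

Lemma shifted_part_inj : injective mu.
Proof.
move=> i j; rewrite /mu => E; apply: val_inj => /=.
by case: (ltngtP i j) => // ij; have := lam_mono (ltnW ij); lia.
Qed.

Lemma sum_lt_ordS (F : 'I_r -> int) (p : 'I_r) :
  \sum_(m < r | (m < p.+1)%N) F m = \sum_(m < r | (m < p)%N) F m + F p.
Proof.
rewrite (bigD1 p) //= addrC; congr (_ + _); apply: eq_bigl => m.
by rewrite ltnS -val_eqE ltn_neqAle andbC.
Qed.

(** A nonzero alternant forces the shifted row sums to be a rearrangement of
    the shifted partition. *)
Lemma alternant_neq0 rho : alternant mu rho != 0 ->
  exists v : 'S_r, forall m, rho m = mu (v m).
Proof.
move=> nz; have [/existsP[v /forallP H]|no] :=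
  boolP [exists v : 'S_r, [forall m, rho m == mu (v m)]].
  by exists v => m; apply/eqP.
case/eqP: nz; rewrite /alternant big1 // => v _.
move: no; rewrite negb_exists => /forallP/(_ v)/negPf->.
by rewrite mulr0.
Qed.

Definition upper_triangular (B : {ffun 'I_r * 'I_r -> 'I_n.+1}) :=
  forall k m : 'I_r, (k < m)%N -> B (m, k) = 0%N :> nat.

(** The first p columns of an upper triangular matrix lie in its first p
    rows. *)
Lemma upper_col_row_sums B p : upper_triangular B ->
  \sum_(m < r | (m < p)%N) (\sum_k B (m, k))%N%:Z =
  \sum_(k < r | (k < p)%N) (\sum_m B (m, k))%N%:Z +
  \sum_(m < r | (m < p)%N) \sum_(k < r | (p <= k)%N) (B (m, k) : nat)%:Z.
Proof.
move=> uB.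
have E (m : 'I_r) : (\sum_k B (m, k))%N%:Z =
   \sum_(k < r | (k < p)%N) (B (m, k) :
     nat)%:Z + \sum_(k < r | (p <= k)%N) (B (m, k) : nat)%:Z.
  rewrite (big_morph Posz PoszD (erefl _)) (bigID (fun k : 'I_r => (k < p)%N)) /=.
  by congr (_ + _); apply: eq_bigl => k; rewrite -leqNgt.
under eq_bigr do rewrite E.
rewrite big_split /= exchange_big /=; congr (_ + _).
apply: eq_bigr => k kp; rewrite (big_morph Posz PoszD (erefl _)).
rewrite [RHS](bigID (fun m : 'I_r => (m < p)%N)) /= [X in _ + X]big1 ?addr0 // => m.
by rewrite -leqNgt => pm; rewrite uB // (leq_trans kp).
Qed.

Lemma row_sums_le (B : {ffun 'I_r * 'I_r -> 'I_n.+1}) (v : 'S_r) (p : nat) :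
  (forall m, shifted_row_sum B m = mu (v m)) ->
  \sum_(m < r | (m < p)%N) (\sum_k B (m, k))%N%:Z <=
  \sum_(m < r | (m < p)%N) (lam m)%:Z.
Proof.
move=> H; rewrite -subr_ge0 -sumrB.
have -> : \sum_(m < r | (m < p)%N) ((lam m)%:Z - (\sum_k B (m, k))%N%:Z)
  = \sum_(m < r | (m < p)%N) mu m - \sum_(m < r | (m < p)%N) mu (v m).
  by rewrite -sumrB; apply: eq_bigr => m _; rewrite -H /shifted_row_sum /mu; ring.
by rewrite subr_ge0; apply: sum_perm_le; apply: shifted_part_anti.
Qed.

Lemma cfdot_cfDet_upper (b : 'I_r -> int) : \sum_c b c = n%:Z ->
  '[cfDet n (fun i => (lam i)%:Z), cfColour n b] =
  \sum_(B | has_col_sums b B && ~~ [exists k, exists m, below_diag B k m])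
    alternant mu (shifted_row_sum (n := n) B).
Proof.
move=> sb; rewrite cfdot_cfDet // (bigID (fun B =>
  [exists k, exists m, below_diag B k m])) /=.
by rewrite (sum_alternant_below sb) add0r.
Qed.

Lemma not_below_upper_triangular (B : {ffun 'I_r * 'I_r -> 'I_n.+1}) :
  reflect (upper_triangular B) (~~ [exists k, exists m, below_diag B k m]).
Proof.
apply: (iffP idP) => [no k m km|uB].
  apply/eqP; rewrite -leqn0 leqNgt; apply: contra no => B0.
  by apply/existsP; exists k; apply/existsP; exists m; rewrite /below_diag km.
by apply/existsP=> -[k /existsP[m /andP[km]]]; rewrite uB.
Qed.

(** An upper triangular matrix with column sums b can only contribute if b is
    dominated by lam. *)
Lemma cfdot_cfDet_eq0 (b : 'I_r -> int) (p : nat) : \sum_c b c = n%:Z ->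
  \sum_(k < r | (k < p)%N) (lam k)%:Z < \sum_(k < r | (k < p)%N) b k ->
  '[cfDet n (fun i => (lam i)%:Z), cfColour n b] = 0.
Proof.
move=> sb; rewrite ltNge => /negP dom; rewrite cfdot_cfDet_upper // big1 // => B.
move=> /andP[/forallP cB /not_below_upper_triangular uB]; apply/eqP; apply/negPn/negP.
move=> /alternant_neq0[v Hv]; apply: dom.
apply: le_trans (row_sums_le p Hv); rewrite upper_col_row_sums //.
rewrite [X in _ <= X + _](eq_bigr b) => [|k _]; last exact/eqP.
by rewrite lerDl; apply: sumr_ge0 => m _; apply: sumr_ge0.
Qed.

Definition diag_matrix : {ffun 'I_r * 'I_r -> 'I_n.+1} :=
  [ffun p => if p.1 == p.2 then inord (lam p.1) else ord0].

Lemma diag_matrixE m k : diag_matrix (m, k) = (if m == k then lam m else 0%N) :> nat.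
Proof.
rewrite ffunE /=; case: ifP => // _; rewrite inordK // ltnS -sum_lam.
by rewrite (bigD1 m) //= leq_addr.
Qed.

(** Equality in the dominance inequalities leaves only the diagonal matrix and
    the identity permutation. *)
Lemma cfdot_cfDet_self :
  '[cfDet n (fun i => (lam i)%:Z), cfColour n (fun i => (lam i)%:Z)] = 1.
Proof.
have sb : \sum_i (lam i)%:Z = n%:Z.
  by rewrite -(big_morph Posz PoszD (erefl _)) sum_lam.
rewrite cfdot_cfDet_upper // (bigD1 diag_matrix) /=; last first.
  apply/andP; split.
    apply/forallP=> k; rewrite (bigD1 k) //= diag_matrixE eqxx big1 ?addn0 // =>
      m /negPf mk.
    by rewrite diag_matrixE mk.
  by apply/not_below_upper_triangular => k m km; rewrite diag_matrixE -val_eqE gtn_eqF.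
rewrite [X in _ + X]big1 ?addr0 =>
  [|B /andP[/andP[/forallP cB /not_below_upper_triangular uB] neB]].
  have rho m : shifted_row_sum diag_matrix m = mu m.
    rewrite /shifted_row_sum (bigD1 m) //= diag_matrixE eqxx big1 ?addn0 // =>
      k /negPf mk.
    by rewrite diag_matrixE eq_sym mk.
  rewrite /alternant (bigD1 1%g) //= big1 => [|v v1].
    rewrite odd_perm1 mul1r addr0; case: forallP => // -[] m.
    by rewrite perm1 rho.
  case: forallP => [H|]; last by rewrite mulr0.
  case/eqP: v1; apply/permP=> m; rewrite perm1; apply: shifted_part_inj.
  by rewrite -(eqP (H m)) rho.
apply/eqP; apply/negPn/negP=> /alternant_neq0[v Hv]; case/eqP: neB.
(* In the p-th inequality the entries right of column p in the first p rows
   are the defect. *)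
have z p (m k : 'I_r) : (m < p)%N -> (p <= k)%N -> B (m, k) = 0%N :> nat.
  move=> mp pk; have := row_sums_le p Hv; rewrite upper_col_row_sums //.
  rewrite (eq_bigr (fun k => (lam k)%:Z)) => [|j _]; last exact/eqP.
  rewrite gerDl => le0; apply/eqP; rewrite -eqz_nat eq_le /= andbT.
  apply: le_trans le0; rewrite (bigD1 m) //= (bigD1 k) //= -addrA lerDl.
  by rewrite addr_ge0 // sumr_ge0 // => j _; apply: sumr_ge0.
have off (m k : 'I_r) : m != k -> B (m, k) = 0%N :> nat.
  rewrite -val_eqE neq_ltn => /orP[mk|km]; last exact: uB.
  exact: (z k).
apply/ffunP=> -[m k]; apply: val_inj; rewrite /= diag_matrixE.
case: ifP => [/eqP<-|/negbT/off //].
apply/eqP; rewrite -eqz_nat -(eqP (cB m)) (bigD1 m) //= big1 ?addn0 // => j.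
exact: off.
Qed.

Lemma sum_shift_perm (w : 'S_r) :
  \sum_i ((lam i)%:Z - i%:Z + (w i)%:Z) = n%:Z.
Proof.
rewrite big_split sumrB /= -(big_morph Posz PoszD (erefl _)) sum_lam.
by rewrite [X in _ - X](reindex_inj (@perm_inj _ w)) /= subrK.
Qed.

(** The first point that a permutation moves is moved upwards, so a content
    in the determinant other than lam itself strictly exceeds lam there. *)
Lemma shift_perm_dominates (w : 'S_r) : w != 1%g ->
  exists p : nat, \sum_(k < r | (k < p)%N) (lam k)%:Z <
                  \sum_(k < r | (k < p)%N) ((lam k)%:Z - k%:Z + (w k)%:Z).
Proof.
move=> w1.
have /existsP[i0 Hi0] : [exists i, w i != i].
  apply: contraR w1; rewrite negb_exists => /forallP H; apply/eqP/permP=> i.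
  by rewrite perm1; have := H i; rewrite negbK => /eqP.
case: (@arg_minnP _ i0 (fun i => w i != i) (fun i => i) Hi0) => i Hi mini.
have fixl (k : 'I_r) : (k < i)%N -> w k = k.
  by move=> ki; apply/eqP; apply: contraLR ki => /mini; rewrite -leqNgt.
have wi : (i < w i)%N.
  rewrite ltn_neqAle eq_sym Hi leqNgt /=; apply/negP => /[dup] lt /fixl /perm_inj E.
  by rewrite E eqxx in Hi.
exists i.+1; rewrite !sum_lt_ordS.
rewrite [X in _ < X + _](eq_bigr (fun k => (lam k)%:Z)) => [|k /fixl->];
  last by rewrite subrK.
by rewrite ltrD2l addrAC -addrA ltrDl subr_gt0.
Qed.

(** In the second factor every term but the leading one has a content that
    strictly exceeds lam in dominance order, hence is orthogonal to cfDet. *)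
Lemma cfDet_norm : '[cfDet n (fun i => (lam i)%:Z)] = 1.
Proof.
rewrite {2}/cfDet cfdot_sumr (bigD1 1%g) //= big1 => [|w w1].
  rewrite odd_perm1 scale1r addr0 -[RHS]cfdot_cfDet_self; congr '[_, _].
  by apply: eq_cfColour => i; rewrite perm1 subrK.
have [p Hp] := shift_perm_dominates w1.
by rewrite cfdotZr (cfdot_cfDet_eq0 _ Hp) ?mulr0 // sum_shift_perm.
Qed.

Lemma cfDet_vchar (lam' : 'I_r -> int) : cfDet n lam' \in 'Z[irr [set: 'S_n]].
Proof.
rewrite rpred_sum // => w _; rewrite rpredZsign.
exact: char_vchar (cfColour_char _ _).
Qed.

(** The determinantal character is irreducible: its norm is 1 and its sign is
    fixed by the positive product with a permutation character. *)
Lemma cfDet_irr : exists i, cfDet n (fun k => (lam k)%:Z) = 'chi_i.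
Proof.
have [e [i E]] := dirrP _ (dirr_norm1 (cfDet_vchar _) cfDet_norm).
exists i; move: E; case: e => [|->]; last by rewrite scale1r.
rewrite expr1 scaleN1r => E; have := cfdot_cfDet_self; rewrite E cfdotNl => E1.
have /natr_ge0 := Cnat_cfdot_char (irr_char i) (cfColour_char n (fun k => (lam k)%:Z)).
by rewrite -oppr_le0 E1 ler10.
Qed.

End DeterminantNorm.

(** * Identification with the irreducible character of a partition *)

Section SignInduction.

Variables (n : nat) (phi : nat -> nat).
Let H := fibre_stab_group n phi.

Definition separated (C : finType) (f : {ffun 'I_n -> C}) :=
  [forall x : 'I_n, forall y : 'I_n, (phi x == phi y) && (f x == f y) ==> (x == y)].

Lemma in_fibre_stabP (s : 'S_n) :
  reflect (forall x : 'I_n, phi (s x) = phi x) (s \in H).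
Proof. by rewrite inE; apply: (iffP forallP) => E x; apply/eqP. Qed.

(** Two points of a fibre with the same colour give a transposition in the
    stabiliser, which cancels the signs in pairs; otherwise only the identity
    contributes. *)
Lemma sum_sign_invariant (C : finType) (f : {ffun 'I_n -> C}) :
  \sum_(s in H | invariant s f) (-1) ^+ odd_perm s = (separated f)%:R :> algC.
Proof.
have [sf|] := boolP (separated f).
  rewrite (big_pred1 1%g) ?odd_perm1 // => s.
  apply/andP/eqP => [[/in_fibre_stabP Hs /invariantP fs]|->]; last first.
    by split; [exact: group1 | apply/invariantP=> x; rewrite perm1].
  apply/permP=> x; rewrite perm1; apply/eqP.
  by have /forallP/(_ x) := forallP sf (s x); rewrite Hs fs !eqxx.
rewrite negb_forall => /existsP[x]; rewrite negb_forall => /existsP[y].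
rewrite negb_imply => /andP[/andP[/eqP pxy /eqP fxy] nxy].
have tH : tperm x y \in H.
  by apply/in_fibre_stabP => z; case: tpermP => // ->.
have ft z : f (tperm x y z) = f z by case: tpermP => // ->.
set S := bigop _ _ _; suff: S = - S.
  by move/eqP; rewrite -addr_eq0 -mulr2n mulrn_eq0 /= => /eqP.
rewrite {1}/S (reindex_inj (mulgI (tperm x y))) -sumrN; apply: eq_big => [s|s _].
  rewrite groupMl //; congr andb; apply/invariantP/invariantP => E z;
    last by rewrite permM E.
  by have := E (tperm x y z); rewrite permM tpermK => ->; rewrite ft.
by rewrite odd_permM odd_tperm nxy signr_addb expr1 mulN1r.
Qed.

Lemma cfdot_Ind_sign (C : finType) (a : C -> int) :
  '['Ind[[set: 'S_n]] (cfSign H), cfColour n a] =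
  #|H|%:R^-1 * #|[set f | has_content a f && separated f]|%:R.
Proof.
rewrite -Frobenius_reciprocity cfdotE; congr (_ * _).
transitivity (\sum_(f | has_content a f) \sum_(s in H | invariant s f) (-1) ^+
  odd_perm s : algC).
  rewrite (exchange_big_dep (mem H)) /= => [|f s _ /andP[]//].
  apply: eq_bigr => s Hs; rewrite cfResE ?subsetT // cfColourE rmorph_nat.
  rewrite cfunElock Hs mulr1n sumr_const mulr_natr; congr (_ *+ _).
  by apply: eq_card => f; rewrite inE unfold_in /=.
under eq_bigr do rewrite sum_sign_invariant.
rewrite -natr_sum -sum1_card; congr _%:R.
rewrite big_mkcond [RHS]big_mkcond; apply: eq_bigr => f _.
by rewrite inE; case: has_content => //=; case: separated.
Qed.

Fact sign_repr_subproof : mx_repr H (fun s : 'S_n =>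
  ((-1) ^+ odd_perm s)%:M : 'M[algC]_1).
Proof.
split=> [|s t _ _]; first by rewrite odd_perm1.
by rewrite odd_permM signr_addb scalar_mxM.
Qed.

(** The sign character is afforded by the one-dimensional representation above;
    that makes its multiplicities natural numbers. *)
Lemma cfSign_char : cfSign H \is a character.
Proof.
suff -> : cfSign H = cfRepr (MxRepresentation sign_repr_subproof) by exact: cfRepr_char.
apply/cfunP=> s; by rewrite !cfunElock mxtrace_scalar.
Qed.

End SignInduction.

Section YoungTableau.

Variables (n : nat) (la : seq nat).
Hypotheses (la_sorted : sorted geq la) (la_sum : sumn la = n).
Let r := size la.

Fact row_of_subproof (x : 'I_n) : (reshape_index la x < r)%N.
Proof. by apply: reshape_indexP; rewrite la_sum. Qed.

Definition row_of : {ffun 'I_n -> 'I_r} := [ffun x => Ordinal (row_of_subproof x)].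

Lemma row_ofE x : row_of x = reshape_index la x :> nat.
Proof. by rewrite ffunE. Qed.

Definition part (i : nat) : nat := nth 0%N la i.

Lemma part_mono i j : (i <= j)%N -> (part j <= part i)%N.
Proof.
move=> ij; have [rj|jr] := leqP r j; first by rewrite /part nth_default.
have tr : transitive geq by move=> a b c ab bc; apply: leq_trans bc ab.
by apply: (sorted_leq_nth tr leqnn 0%N la_sorted) => //; rewrite inE (leq_ltn_trans ij).
Qed.

Lemma sum_part : (\sum_(i < r) part i)%N = n.
Proof. by rewrite -la_sum sumnE (big_nth 0%N) big_mkord. Qed.

Lemma part_le i : (part i <= n)%N.
Proof.
have [ri|ir] := leqP r i; first by rewrite /part nth_default.
by rewrite -[X in (_ <= X)%N]sum_part (bigD1 (Ordinal ir)) //= leq_addr.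
Qed.

Lemma col_lt_part x : (x < n)%N -> (reshape_offset la x < part (reshape_index la x))%N.
Proof. by move=> xn; apply: reshape_offsetP; rewrite la_sum. Qed.

Lemma cell_inj (x y : 'I_n) : reshape_index la x = reshape_index la y ->
  reshape_offset la x = reshape_offset la y -> x = y.
Proof.
by move=> E1 E2; apply: val_inj;
  rewrite /= -[LHS](reshape_indexK la) E1 E2 reshape_indexK.
Qed.

Lemma fibre_card_row_of i : fibre_card row_of i = part i.
Proof.
have lt (c : 'I_(part i)) :
  (flatten_index la i c < n)%N by rewrite -la_sum flatten_indexP.
have inj : injective (fun c => Ordinal (lt c)).
  move=> c d [E]; apply: val_inj => /=.
  by rewrite -(flatten_indexKr (ltn_ord c)) E flatten_indexKr.
rewrite -[RHS]card_ord -(card_imset _ inj); apply: eq_card => x; rewrite inE.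
rewrite -val_eqE /= row_ofE; apply/eqP/imsetP => [E|[c _ ->]]; last first.
  by rewrite /= flatten_indexKl.
have lc : (reshape_offset la x < part i)%N by rewrite -E col_lt_part.
by exists (Ordinal lc) => //; apply: val_inj; rewrite /= -E reshape_indexK.
Qed.

Lemma row_of_content : has_content (fun i : 'I_r => (part i)%:Z) row_of.
Proof. by apply/has_contentP=> i; rewrite fibre_card_row_of. Qed.

Lemma Ind_row_stab : 'Ind[[set: 'S_n], row_stab n la] 1 =
  cfColour n (fun i : 'I_r => (part i)%:Z).
Proof.
apply: Ind1_fibre_stab row_of_content => x y.
by rewrite -val_eqE /= !row_ofE.
Qed.

Notation col x := (reshape_offset la x).

(** If the column has a cell in row p or lower then it meets all of the first p
    rows, and at most p colours are available; otherwise it lies entirely in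
    these rows. *)
Lemma separated_column_le (f : {ffun 'I_n -> 'I_r}) (p c : nat) :
  separated (reshape_offset la) f ->
  (#|[set x : 'I_n | (col x == c) && (f x < p)]| <=
   #|[set x : 'I_n | (col x == c) && (row_of x < p)]|)%N.
Proof.
move=> sf.
have [/existsP[y /andP[/eqP cy py]]|] :=
  boolP [exists y : 'I_n, (col y == c) && (p <= row_of y)%N].
  apply: (@leq_trans p).
    have inj : {in [set x : 'I_n | (col x == c) && (f x < p)%N] &, injective f}.
      move=> x z; rewrite !inE => /andP[/eqP xc _] /andP[/eqP zc _] E.
      by have /forallP/(_ z) := forallP sf x; rewrite xc zc E !eqxx => /eqP.
    rewrite -(card_in_imset inj) -[X in (_ <= X)%N]card_ord.
    have pr : (p <= r)%N by apply: leq_trans py _; apply: ltnW.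
    have wi : injective (widen_ord pr) by move=> i j [E]; apply: val_inj.
    rewrite -(card_imset _ wi); apply: subset_leq_card.
    apply/subsetP=> _ /imsetP[x + ->]; rewrite inE => /andP[_ fp].
    by apply/imsetP; exists (Ordinal fp) => //; apply: val_inj.
  have lt (i : 'I_p) : (c < part i)%N.
    apply: (@leq_trans (part (row_of y))); last first.
      by apply: part_mono; apply: ltnW (leq_trans (ltn_ord i) py).
    by rewrite row_ofE -cy col_lt_part.
  have inj : injective (fun i : 'I_p => (flatten_index la i c)).
    by move=> i j E; apply: val_inj;
      rewrite /= -(flatten_indexKl (lt i)) E flatten_indexKl.
  have lt' (i : 'I_p) : (flatten_index la i c < n)%N by rewrite -la_sum flatten_indexP.
  have inj' : injective (fun i : 'I_p => Ordinal (lt' i)) by move=> i j [/inj].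
  rewrite -[X in (X <= _)%N]card_ord -(card_imset _ inj'); apply: subset_leq_card.
  apply/subsetP=> _ /imsetP[i _ ->]; rewrite inE row_ofE /=.
  by rewrite flatten_indexKl // flatten_indexKr // eqxx /=.
rewrite negb_exists => /forallP no; apply: subset_leq_card; apply/subsetP=> x.
rewrite !inE => /andP[xc _]; rewrite xc /=.
by have := no x; rewrite xc /= -ltnNge.
Qed.

Lemma card_below (f : {ffun 'I_n -> 'I_r}) (p : nat) :
  (\sum_(i < r | (i < p)%N) fibre_card f i)%N = #|[set x | (f x < p)%N]|.
Proof.
rewrite -sum1_card (partition_big f (fun i => (i < p)%N)) /=; last by move=> x;
  rewrite inE.
apply: eq_bigr => i ip; rewrite /fibre_card -sum1_card; apply: eq_bigl => x.
by rewrite !inE; case: eqP => [->|]; rewrite ?ip ?andbF.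
Qed.

Lemma card_by_columns (P : pred 'I_n) :
  #|[set x | P x]| = (\sum_(c < n) #|[set x : 'I_n | (col x == c) && P x]|)%N.
Proof.
have coln (x : 'I_n) : (col x < n)%N.
  exact: leq_trans (col_lt_part (ltn_ord x)) (part_le _).
rewrite -sum1_card (partition_big (fun x => Ordinal (coln x)) predT) //=.
apply: eq_bigr => c _; rewrite -sum1_card; apply: eq_bigl => x.
by rewrite !inE -val_eqE andbC.
Qed.

(** The inequality of Gale and Ryser, summed over the columns. *)
Lemma separated_dominated (f : {ffun 'I_n -> 'I_r}) (p : nat) :
  separated (reshape_offset la) f ->
  (\sum_(i < r | (i < p)%N) fibre_card f i <= \sum_(i < r | (i < p)%N) part i)%N.
Proof.
move=> sf; rewrite -(eq_bigr _ (fun i _ => fibre_card_row_of i)) !card_below.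
by rewrite !card_by_columns; apply: leq_sum => c _; apply: separated_column_le.
Qed.

(** Equality throughout the column inequalities: a separated colouring with
    the content of the tableau uses in each column the colours of its rows, so
    it is the row colouring up to a column permutation. *)
Lemma separated_pullback (f : {ffun 'I_n -> 'I_r}) :
  separated (reshape_offset la) f -> fibre_card f =1 fibre_card row_of ->
  exists2 y, y \in col_stab n la & f = pullback y row_of.
Proof.
move=> sf Ef.
have eqc (c : 'I_n) p : #|[set x : 'I_n | (col x == c) && (f x < p)%N]| =
    #|[set x : 'I_n | (col x == c) && (row_of x < p)%N]|.
  have : (\sum_(c < n) #|[set x : 'I_n | (col x == c) && (f x < p)]| ==
     \sum_(c < n) #|[set x : 'I_n | (col x == c) && (row_of x < p)]|)%N.
    by rewrite -!card_by_columns -!card_below (eq_bigr _ (fun i _ => Ef i)).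
  have [_ ->] := leqif_sum (fun (d : 'I_n) (_ : true) =>
    leqif_eq (separated_column_le p d sf)).
  by move=> /forallP/(_ c)/eqP.
have split_card (g : {ffun 'I_n -> 'I_r}) (c i : nat) :
   (#|[set x : 'I_n | (col x == c) && (g x < i.+1)]| =
    #|[set x : 'I_n | (col x == c) && (g x < i)]| +
    #|[set x : 'I_n | (col x == c) && (g x == i :> nat)]|)%N.
  rewrite -cardsUI [X in (_ + X)%N](_ : _ = 0%N) ?addn0; last first.
    apply/eqP; rewrite cards_eq0; apply/eqP/setP=> x; rewrite !inE.
    by case: ltngtP; rewrite ?andbF.
  by apply: eq_card => x; rewrite !inE ltnS leq_eqVlt orbC andb_orr.
have coln (x : 'I_n) : (col x < n.+1)%N.
  by rewrite ltnS; apply: leq_trans (ltnW (col_lt_part (ltn_ord x))) (part_le _).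
pose cc (g : {ffun 'I_n -> 'I_r}) := [ffun x => (g x, Ordinal (coln x))].
have Ecc g ic : fibre_card (cc g) ic = #|[set x : 'I_n | (col x == ic.2) &&
  (g x == ic.1 :> nat)]|.
  by apply: eq_card => x; rewrite !inE ffunE; case: ic => i c; rewrite xpair_eqE andbC.
have [y Ey] : exists y, cc f = pullback y (cc row_of).
  apply: same_content_pullback => -[i c]; rewrite !Ecc /=.
  have [cn|nc] := ltnP c n; last first.
    apply: eq_card => x; rewrite !inE [col x == c](_ : _ = false) //.
    apply: contraTF (leq_trans (col_lt_part (ltn_ord x)) (part_le _)) => /eqP->.
    by rewrite -leqNgt.
  apply/eqP; rewrite -(eqn_add2l #|[set x : 'I_n | (col x == c) && (f x < i)%N]|).
  by rewrite -split_card (eqc (Ordinal cn)) (eqc (Ordinal cn) i.+1) -split_card.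
exists y.
  apply/in_fibre_stabP=> x; have /ffunP/(_ x) := Ey; rewrite !ffunE.
  by case.
apply/ffunP=> x; have /ffunP/(_ x) := Ey; rewrite !ffunE.
by case.
Qed.

Notation cfSignCol := ('Ind[[set: 'S_n], col_stab n la] (cfSign (col_stab n la))).

Lemma cfdot_sign_self : '[cfSignCol, cfColour n (fun i : 'I_r => (part i)%:Z)] = 1.
Proof.
rewrite cfdot_Ind_sign.
have inj : {in col_stab n la &, injective (fun y => pullback y row_of)}.
  move=> y z /in_fibre_stabP Hy /in_fibre_stabP Hz /ffunP E; apply/permP=> x.
  apply: cell_inj; last by rewrite Hy Hz.
  by have := congr1 val (E x); rewrite !ffunE /= .
rewrite [#|[set f | _]|](_ : _ = #|col_stab n la|) ?mulVf ?neq0CG //.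
rewrite -(card_in_imset inj); apply: eq_card => f; rewrite inE.
apply/andP/imsetP => [[/has_contentP fa sf]|[y /in_fibre_stabP Hy ->]].
  apply: separated_pullback => // i; apply/eqP; rewrite -eqz_nat.
  by rewrite fa fibre_card_row_of.
rewrite has_content_pullback row_of_content; split=> //.
apply/forallP=> x; apply/forallP=> z; apply/implyP=> /andP[/eqP cxz].
rewrite -val_eqE !ffunE /= => /eqP rxz; apply/eqP; apply: (@perm_inj _ y).
by apply: cell_inj => //; rewrite !Hy.
Qed.

Lemma cfdot_sign_eq0 (a : 'I_r -> int) (p : nat) :
  \sum_(k < r | (k < p)%N) (part k)%:Z < \sum_(k < r | (k < p)%N) a k ->
  '[cfSignCol, cfColour n a] = 0.
Proof.
move=> dom; rewrite cfdot_Ind_sign [#|[set f | _]|](_ : _ = 0%N) ?mulr0 //.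
apply/eqP; rewrite cards_eq0; apply/eqP/setP=> f; rewrite !inE.
apply/negP=> /andP[/has_contentP fa sf].
move: dom; rewrite -(eq_bigr _ (fun i _ => fa i)) -!(big_morph Posz PoszD (erefl _)).
by rewrite ltz_nat ltnNge separated_dominated.
Qed.

Lemma cfdot_sign_cfDet : '[cfSignCol, cfDet n (fun i : 'I_r => (part i)%:Z)] = 1.
Proof.
have mono (i j : 'I_r) : (i <= j)%N -> (part j <= part i)%N by exact: part_mono.
rewrite /cfDet cfdot_sumr (bigD1 1%g) //= big1 => [|w w1].
  rewrite odd_perm1 scale1r addr0 -[RHS]cfdot_sign_self; congr '[_, _].
  by apply: eq_cfColour => i; rewrite perm1 subrK.
have [p Hp] := shift_perm_dominates (fun i : 'I_r => part i) w1.
by rewrite cfdotZr (cfdot_sign_eq0 Hp) mulr0.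
Qed.

(** Products of characters are sums of products of multiplicities; as the two
    induced characters have product 1, they share a single constituent, and
    the irreducible determinantal character is one. *)
Theorem irrS_cfDet : irrS n la = cfDet n (fun i : 'I_r => (part i)%:Z).
Proof.
have mono (i j : 'I_r) : (i <= j)%N -> (part j <= part i)%N by exact: part_mono.
have [i Ei] := cfDet_irr mono sum_part.
set M := cfColour n (fun i : 'I_r => (part i)%:Z).
have Mi : '[M, 'chi_i] = 1.
  by rewrite -Ei cfdotC cfdot_cfDet_self // ?sum_part // conjC1.
have Si : '[cfSignCol, 'chi_i] = 1 by rewrite -Ei cfdot_sign_cfDet.
have Sch : cfSignCol \is a character by rewrite cfInd_char // cfSign_char.
have Mch : M \is a character := cfColour_char _ _.
have nn k : 0 <= '[cfSignCol, 'chi_k] * '[M, 'chi_k]^*.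
  have nS : '[cfSignCol, 'chi_k] \is a Num.nat by exact: Cnat_cfdot_char_irr.
  have nM : '[M, 'chi_k] \is a Num.nat by exact: Cnat_cfdot_char_irr.
  by rewrite natr_ge0 // conj_natr // rpredM.
rewrite /irrS Ind_row_stab -/M.
case: pickP => [j /andP[jM jS]|/(_ i)]; last first.
  by rewrite !irr_consttE Mi Si oner_eq0.
have [->|ji] := eqVneq j i; first by rewrite Ei.
have := cfdot_sign_self; rewrite cfdot_sum_irr (bigD1 i) //= (bigD1 j) //= -/M Mi Si.
move/eqP; rewrite conjC1 mulr1 -subr_eq0 [1 + _]addrC addrK paddr_eq0 ?sumr_ge0 //.
by rewrite !irr_consttE in jM jS; rewrite mulf_eq0 conjC_eq0 (negPf jM) (negPf jS).
Qed.

End YoungTableau.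

(** * Subsets fixed by the square of a permutation, and pairs of fixed subsets *)

Section SquareOfPermutation.

Variables (n : nat) (g : 'S_n).
Implicit Types (y s f : {ffun 'I_n -> bool}).

Definition twisted y f := [forall x, f (g x) == f x (+) y x].
Definition card_on y s : nat := #|[set x | y x && s x]|.
Definition card_off y s : nat := #|[set x | ~~ y x && s x]|.
Definition addf s f : {ffun 'I_n -> bool} := [ffun x => s x (+) f x].

Lemma twistedP y f : reflect (forall x, f (g x) = f x (+) y x) (twisted y f).
Proof. by apply: (iffP forallP) => H c; apply/eqP. Qed.

Lemma addfK f : involutive (addf f).
Proof. by move=> s; apply/ffunP=> x; rewrite !ffunE addKb. Qed.

(** If f alternates along the cycles in y, then g exchanges the points of s on
    which f is true and those on which it is false. *)
Lemma card_on_split y f s : invariant g y -> invariant g s -> twisted y f ->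
  card_on y s = (#|[set x | y x && s x && f x]|).*2.
Proof.
move=> /invariantP yi /invariantP si /twistedP ft.
rewrite /card_on -(cardsID [set x | f x]) -addnn; congr (_ + _)%N.
  by apply: eq_card => x; rewrite !inE.
rewrite -(card_preimset _ (@perm_inj _ g)); apply: eq_card => x.
by rewrite !inE yi si ft; case: (y x) (s x) (f x) => [] [] [].
Qed.

Lemma card_twisted y f : invariant g y -> twisted y f ->
  ((card_off y f + card_on y f).*2 = (card_off y f).*2 + #|[set x | y x]|)%N.
Proof.
move=> yi ft; rewrite doubleD; congr (_ + _)%N.
have ti : invariant g [ffun=> true] by apply/invariantP=> x; rewrite !ffunE.
have := card_on_split yi ti ft; rewrite /card_on => E.
transitivity #|[set x | y x && [ffun=> true] x]|.
  by rewrite E; congr _.*2; apply: eq_card => x; rewrite !inE ffunE andbT.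
by apply: eq_card => x; rewrite !inE ffunE andbT.
Qed.

(** Number each orbit inside y from a chosen point; the parity of the position
    is a twisted colouring, the orbits being even. *)
Lemma twisted_ex y : invariant g y ->
  (forall s, invariant g s -> ~~ odd (card_on y s)) -> exists f, twisted y f.
Proof.
move=> /invariantP yi ev.
have pg x : porbit g (g x) = porbit g x by have := porbit_perm g 1 x; rewrite expg1.
pose rep x := odflt x [pick z in porbit g x].
have repP x : rep x \in porbit g x.
  by rewrite /rep; case: pickP => // /(_ x); rewrite porbit_id.
have repg x : rep (g x) = rep x.
  rewrite /rep pg; case: pickP => // /(_ x); rewrite porbit_id //.
(* The length of the cycle of x, and the position of x after rep x in it. *)
pose m x := #|porbit g (rep x)|.
have mE x : porbit g (rep x) = porbit g x.
  by apply/eqP; rewrite eq_porbit_mem repP.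
have mg x : m (g x) = m x by rewrite /m repg.
pose pos x := index x (traject g (rep x) (m x)).
have posm x : (pos x < m x)%N.
  rewrite -[X in (_ < X)%N](size_traject g (rep x)) index_mem -porbit_traject.
  by rewrite porbit_sym.
have posE x : iter (pos x) g (rep x) = x.
  by rewrite -(nth_traject g (posm x)) nth_index // -index_mem size_traject posm.
have pos_uniq x i : (i < m x)%N -> iter i g (rep x) = x -> pos x = i.
  move=> im E; rewrite /pos -{1}E -(nth_traject g im) index_uniq ?size_traject //.
  exact: uniq_traject_porbit.
have meven x : y x -> ~~ odd (m x).
  move=> yx; have := ev [ffun z => z \in porbit g (rep x)].
  have -> : card_on y [ffun z => z \in porbit g (rep x)] = m x.
    apply: eq_card => z; rewrite inE ffunE mE.
    case zx: (z \in porbit g x); rewrite ?andbF // andbT.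
    have /porbitP[i ->] := zx.
    by elim: i => [|i IH]; rewrite ?perm1 // expgSr permM yi.
  apply; apply/invariantP=> z; rewrite !ffunE.
  by rewrite -!eq_porbit_mem pg.
exists [ffun x => y x && odd (pos x)]; apply/twistedP=> x; rewrite !ffunE yi.
case yx: (y x) => //=; have mx := meven x yx; rewrite addbT.
(* At the end of a cycle the position returns to 0, an even cycle length
   making this a change of parity too. *)
have [lt|] := ltnP (pos x).+1 (m x).
  by rewrite (pos_uniq _ (pos x).+1) ?mg // repg iterS posE.
rewrite leq_eqVlt ltnS leqNgt posm orbF => /eqP E.
rewrite (pos_uniq _ 0%N) ?mg ?(leq_ltn_trans _ (posm x)) //.
  by move: mx; rewrite E /= negbK => ->.
by rewrite /= repg -[in RHS](posE x) -iterS -E /m iter_porbit.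
Qed.

(** Adding a twisted colouring of the part y matches the invariant colourings
    with the twisted ones, and makes all signs 1. If there is none, an
    invariant subset of odd size cancels the signs. *)
Lemma sum_sign_on y N : invariant g y ->
  \sum_(s | invariant g s && (card_off y s == N)) (-1) ^+ card_on y s =
  #|[set f | twisted y f && (card_off y f == N)]|%:R :> algC.
Proof.
move=> yi; have [/existsP[f0 tf0]|notw] := boolP [exists f, twisted y f].
  pose u : {ffun 'I_n -> bool} := [ffun x => y x && f0 x].
  have tu : twisted y u.
    apply/twistedP=> x; rewrite !ffunE (invariantP _ _ yi) (twistedP _ _ tf0).
    by case: (y x) (f0 x) => [] [].
  rewrite (eq_bigr (fun=> 1)) => [|s /andP[si _]]; last first.
    by rewrite (card_on_split yi si tf0) -signr_odd odd_double.
  rewrite sumr_const; congr _%:R.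
  rewrite -[RHS](card_imset _ (can_inj (addfK u))); apply: eq_card => s.
  have off s' : card_off y (addf u s') = card_off y s'.
    by apply: eq_card => x; rewrite !inE !ffunE; case: (y x).
  have inv s' : invariant g (addf u s') = twisted y s'.
    apply/invariantP/twistedP => H x; have := H x; rewrite !ffunE;
      rewrite (invariantP _ _ yi) (twistedP _ _ tf0);
      by case: (y x) (f0 x) (s' x) (s' (g x)) => [] [] [] [].
  apply/idP/imsetP => [H|[f + ->]].
    exists (addf u s); last by rewrite addfK.
    rewrite inE -inv addfK off; exact: H.
  by rewrite inE unfold_in /= inv off.
rewrite [X in X%:R](_ : _ = 0%N); last first.
  apply/eqP; rewrite cards_eq0; apply/eqP/setP=> f; rewrite !inE.
  by move: notw; rewrite negb_exists => /forallP/(_ f)/negPf->.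
have [s0 s0i s0odd] : exists2 s0, invariant g s0 & odd (card_on y s0).
  have [/existsP[s0 /andP[]]|] := boolP [exists s, invariant g s && odd (card_on y s)].
    by exists s0.
  rewrite negb_exists => /forallP no; case/existsP: notw.
  apply: twisted_ex yi _ => s si; by have := no s; rewrite si.
pose u : {ffun 'I_n -> bool} := [ffun x => y x && s0 x].
set S := bigop _ _ _; suff: S = - S.
  by move/eqP; rewrite -addr_eq0 -mulr2n mulrn_eq0 /= => /eqP.
rewrite {1}/S (reindex_inj (can_inj (addfK u))) -sumrN; apply: eq_big => [s|s _].
  congr andb; last first.
    by congr (_ == _); apply: eq_card => x; rewrite !inE !ffunE; case: (y x).
  apply/invariantP/invariantP => H x; have := H x; rewrite !ffunE;
      rewrite (invariantP _ _ yi) (invariantP _ _ s0i);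
      by case: (y x) (s0 x) (s x) (s (g x)) => [] [] [] [].
rewrite -signr_odd (_ : odd _ = ~~ odd (card_on y s)) ?signrN ?signr_odd //.
suff: odd (card_on y (addf u s)) = odd (card_on y s) (+) odd (card_on y s0).
  by rewrite s0odd addbT.
have E : (card_on y (addf u s) + (#|[set x | y x && s x && s0 x]|).*2 =
          card_on y s + card_on y s0)%N.
  rewrite /card_on -[in RHS]cardsUI -addnn addnA; congr (_ + _)%N.
    rewrite -cardsUI [X in (_ + X)%N](_ : _ = 0%N) ?addn0.
      by apply: eq_card => x; rewrite !inE ?ffunE; case: (y x) (s x) (s0 x) => [] [] [].
    apply/eqP; rewrite cards_eq0; apply/eqP/setP=> x.
    by rewrite !inE ?ffunE; case: (y x) (s x) (s0 x) => [] [] [].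
  by apply: eq_card => x; rewrite !inE; case: (y x) (s x) (s0 x) => [] [] [].
by have := congr1 odd E; rewrite !oddD odd_double addbF.
Qed.

Definition pairf (ys : {ffun 'I_n -> bool} * {ffun 'I_n -> bool}) : {ffun 'I_n ->
  bool * bool} :=
  [ffun x => (ys.1 x, ys.2 x)].

Definition unpairf (q : {ffun 'I_n -> bool * bool}) :
   {ffun 'I_n -> bool} * {ffun 'I_n -> bool} := ([ffun x => (q x).1], [ffun x =>
     (q x).2]).

Lemma pairfK : cancel pairf unpairf.
Proof. by case=> y s; congr pair; apply/ffunP=> x; rewrite !ffunE. Qed.

Lemma unpairfK : cancel unpairf pairf.
Proof. by move=> q; apply/ffunP=> x; rewrite !ffunE; case: (q x). Qed.

Lemma invariant_pairf y s : invariant g (pairf (y, s)) = invariant g y && invariant g s.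
Proof.
apply/invariantP/andP => [H|[/invariantP yi /invariantP si] x]; last first.
  by rewrite !ffunE /= yi si.
by split; apply/invariantP=> x; have := H x; rewrite !ffunE => -[].
Qed.

Definition subset_content (k : nat) (c : bool) : int :=
  if c then k%:Z else n%:Z - k%:Z.

(** Contents for (y, s) with j points in s but not in y, and with i points of
    y in s, where 2 k counts y once and the points of s outside y twice. *)
Definition square_content (k j i : nat) (c : bool * bool) : int :=
  match c with
  | (false, false) => n%:Z - (2 * k)%:Z + j%:Z
  | (false, true) => j%:Z
  | (true, true) => i%:Z
  | (true, false) => (2 * k)%:Z - (2 * j)%:Z - i%:Z
  end.

Lemma fibre_card_pairf y s :
  [/\ fibre_card (pairf (y, s)) (true, true) = card_on y s,
      fibre_card (pairf (y, s)) (false, true) = card_off y s,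
      (fibre_card (pairf (y, s)) (true, true) + fibre_card (pairf (y, s)) (true, false)
         = #|[set x | y x]|)%N &
      (fibre_card (pairf (y, s)) (true, true) + fibre_card (pairf (y, s)) (true, false)
       + fibre_card (pairf (y, s)) (false, true) + fibre_card (pairf (y, s)) (false,
         false) = n)%N].
Proof.
split.
- by apply: eq_card => x; rewrite !inE !ffunE xpair_eqE !eqb_id.
- by apply: eq_card => x; rewrite !inE !ffunE xpair_eqE eqb_id; case: (y x).
- rewrite /fibre_card -cardsUI [X in (_ + X)%N](_ : _ = 0%N) ?addn0.
    by apply: eq_card => x; rewrite !inE !ffunE !xpair_eqE; case: (y x) (s x) => [] [].
  apply/eqP; rewrite cards_eq0; apply/eqP/setP=> x.
  by rewrite !inE !ffunE !xpair_eqE; case: (y x) (s x) => [] [].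
rewrite -[RHS](sum_fibre_card (pairf (y, s))).
have -> : (\sum_c fibre_card (pairf (y, s)) c =
  \sum_(a : bool) \sum_(b : bool) fibre_card (pairf (y, s)) (a, b))%N.
  by rewrite pair_bigA; apply: eq_bigr => -[].
by rewrite !big_bool /= !addnA.
Qed.

Lemma has_content_subset k f :
  has_content (subset_content k) f = (#|[set x | f x]| == k).
Proof.
have Et : fibre_card f true = #|[set x | f x]|.
  by apply: eq_card => x; rewrite !inE eqb_id.
have := sum_fibre_card f; rewrite big_bool /= Et => sE.
apply/has_contentP/eqP => [/(_ true)|E]; first by rewrite Et /= => -[].
case=> /=; first by rewrite Et E.
have : (k + fibre_card f false = n)%N by rewrite -[k]E.
by lia.
Qed.

Lemma card_off_on y f : #|[set x | f x]| = (card_off y f + card_on y f)%N.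
Proof.
rewrite -(cardsID [set x | y x]) addnC; congr (_ + _)%N.
  by apply: eq_card => x; rewrite !inE andbC.
by apply: eq_card => x; rewrite !inE andbC.
Qed.

(** Write f x (+) f (g x) as y x: the subsets f fixed by the square of g are
    the twisted colourings of the g-invariant sets y. *)
Lemma numfix_sqr k :
  (numfix (subset_content k) (g ^+ 2)%g)%:R =
  \sum_(j < k.+1) \sum_(i < (2 * k).+1)
     (-1) ^+ i * (numfix (square_content k j i) g)%:R :> algC.
Proof.
(* Twice the size of s if s is twisted over y, as then s has half of y. *)
pose wt y s := ((card_off y s).*2 + #|[set x | y x]|)%N.
transitivity (\sum_(y | invariant g y) \sum_(s | invariant g s && (wt y s == 2 * k)%N)
   (-1) ^+ card_on y s : algC).
  pose dy f : {ffun 'I_n -> bool} := [ffun x => f x (+) f (g x)].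
  have sqi f : invariant (g ^+ 2)%g f = invariant g (dy f).
    apply: eq_forallb => x; rewrite !ffunE expgS expg1 permM.
    by case: (f x) (f (g x)) (f (g (g x))) => [] [] [].
  rewrite /numfix -sum1_card natr_sum (partition_big dy (invariant g)) /=; last first.
    by move=> f; rewrite inE sqi => /andP[].
  apply: eq_bigr => y yi.
  have tw f : twisted y f = (dy f == y).
    apply/twistedP/eqP => [H|<- x]; last by rewrite !ffunE addKb.
    by apply/ffunP=> x; rewrite !ffunE H addKb.
  pose N := (k - (#|[set x | y x]|)./2)%N.
  have [/andP[evY leY]|nY] := boolP (~~ odd #|[set x | y x]| &&
    ((#|[set x | y x]|)./2 <= k)%N).
    have EY : (#|[set x | y x]| = (#|[set x | y x]|)./2.*2)%N.
      by rewrite -[LHS]odd_double_half (negPf evY).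
    have wtE s : (wt y s == 2 * k)%N = (card_off y s == N).
      rewrite /wt /N; apply/eqP/eqP; lia.
    under [RHS]eq_bigl do rewrite wtE.
    rewrite (sum_sign_on _ yi) -sum1_card natr_sum; apply: eq_bigl => f.
    rewrite !inE sqi has_content_subset -tw; have [tf|] := boolP (twisted y f);
      rewrite ?andbF //=.
    rewrite andbT; move: tf; rewrite tw => /eqP dE; rewrite dE yi andbT.
    have := card_twisted yi (_ : twisted y f); rewrite tw dE eqxx => /(_ isT).
    by rewrite (card_off_on y f) /N => E; apply/eqP/eqP; lia.
  (* If y has odd or too large size, both sides are empty. *)
  rewrite [RHS]big1 => [|s /andP[_ /eqP E]].
    rewrite big1 // => f; rewrite inE has_content_subset -tw (card_off_on y f) =>
      /andP[/andP[/eqP E _] tf].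
    have := card_twisted yi tf; rewrite E => E2.
    case/negP: nY; apply/andP; split; last by lia.
    by have := congr1 odd E2; rewrite oddD !odd_double /= => <-.
  case/negP: nY; apply/andP; split; last by move: E; rewrite /wt; lia.
  by have := congr1 odd E; rewrite /wt oddD odd_double mul2n odd_double /= => ->.
rewrite pair_big_dep /= (reindex unpairf) /=; last first.
  by exists pairf => q _; rewrite ?pairfK ?unpairfK.
pose code (q : {ffun 'I_n -> bool * bool}) : 'I_k.+1 * 'I_(2 * k).+1 :=
  (inord (fibre_card q (false, true)), inord (fibre_card q (true, true))).
rewrite (partition_big code predT) //= pair_bigA /=.
apply: eq_bigr => -[j i] _ /=; rewrite /numfix -sum1_card natr_sum big_distrr /=.
apply: eq_big => [q|q]; have [[y s] ->] : exists ys, q =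
  pairf ys by exists (unpairf q); rewrite unpairfK.
- case: (pairfK (y, s)) => -> ->; rewrite inE invariant_pairf.
  case: (invariant g y) => /=; last by rewrite andbF.
  case: (invariant g s) => /=; last by rewrite andbF.
  have [E1 E2 E3 E4] := fibre_card_pairf y s.
  rewrite andbT /code /wt -E2 -E3.
  apply/andP/has_contentP => [[/eqP W /eqP[Ej Ei]]|H].
    have lj : (fibre_card (pairf (y, s)) (false, true) < k.+1)%N by lia.
    have li : (fibre_card (pairf (y, s)) (true, true) < (2 * k).+1)%N by lia.
    have := congr1 val Ej; have := congr1 val Ei; rewrite /= !inordK // => ei ej.
    by case=> -[] [] /=; lia.
  have := H (true, true); have := H (true, false);
    have := H (false, true) => /= H1 H2 H3.
  split; first by apply/eqP; lia.
  have lj : (fibre_card (pairf (y, s)) (false, true) < k.+1)%N by have := ltn_ord j;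
    lia.
  have li : (fibre_card (pairf (y, s)) (true, true) < (2 * k).+1)%N by have :=
    ltn_ord i; lia.
  by apply/eqP; congr pair; apply: val_inj; rewrite /= inordK //; lia.
- case: (pairfK (y, s)) => -> -> /andP[/andP[_ /eqP W] /eqP[Ej Ei]]; rewrite mulr1;
  congr (_ ^+ _).
have [E1 E2 E3 E4] := fibre_card_pairf y s.
have := congr1 val Ei; rewrite /= inordK ?E1 //.
by move: W; rewrite /wt -E3 -E1; lia.
Qed.

End SquareOfPermutation.

Section ProductOfSubsets.

Variables (n : nat) (g : 'S_n).

Definition product_content (k l j : nat) (c : bool * bool) : int :=
  match c with
  | (true, true) => j%:Z
  | (true, false) => k%:Z - j%:Z
  | (false, true) => l%:Z - j%:Z
  | (false, false) => n%:Z - k%:Z - l%:Z + j%:Z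
  end.

(** A k-subset and an l-subset are classified by the size j of their
    intersection. *)
Lemma numfix_mul k l :
  (numfix (subset_content n k) g * numfix (subset_content n l) g =
   \sum_(j < k.+1) numfix (product_content k l j) g)%N.
Proof.
rewrite /numfix -cardsX -sum1_card (reindex (@unpairf n)) /=; last first.
  by exists (@pairf n) => q _; rewrite ?pairfK ?unpairfK.
pose code (q : {ffun 'I_n -> bool * bool}) : 'I_k.+1 :=
  inord (fibre_card q (true, true)).
rewrite (partition_big code predT) //=; apply: eq_bigr => j _.
rewrite -sum1_card; apply: eq_bigl => q.
have [[y s] ->] : exists ys, q = pairf ys by exists (unpairf q); rewrite unpairfK.
rewrite pairfK !inE invariant_pairf !has_content_subset /=.
case: (invariant g y) => /=; last by rewrite !andbF.
case: (invariant g s) => /=; last by rewrite !andbF.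
have [E1 E2 E3 E4] := fibre_card_pairf y s.
rewrite !andbT (card_off_on y s) -E1 -E2 -E3.
apply/andP/has_contentP => [[/andP[/eqP Ek /eqP El] /eqP Ej]|H].
  have lj : (fibre_card (pairf (y, s)) (true, true) < k.+1)%N by lia.
  have := congr1 val Ej; rewrite /= inordK // => ej.
  by case=> -[] [] /=; lia.
have := H (true, true); have := H (true, false); have := H (false, true) => /= H1 H2 H3.
have lj : (fibre_card (pairf (y, s)) (true, true) < k.+1)%N by have := ltn_ord j; lia.
split; first by apply/andP; split; apply/eqP; lia.
by apply/eqP/val_inj; rewrite /= inordK //; lia.
Qed.

End ProductOfSubsets.

(** * Computing with formal combinations of compositions *)

Section FormalCharacters.

Variable n : nat.

Definition cfSeq (s : seq int) : 'CF([set: 'S_n]) :=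
  cfColour n (fun i : 'I_(size s) => s`_i).

Lemma cfColour_enum (C : finType) (a : C -> int) (cs : seq C) :
  uniq cs -> cs =i predT -> cfColour n a = cfSeq (map a cs).
Proof.
move=> ucs csT.
have lt c : (index c cs < size (map a cs))%N by rewrite size_map index_mem csT.
apply: (@cfColour_rename _ _ _ (fun c => Ordinal (lt c))) => [c d [E]|c|i ni].
- by rewrite -[c](nth_index c (s := cs)) ?csT // E nth_index ?csT.
- by rewrite /= (nth_map c) ?index_mem ?csT // nth_index ?csT.
have li : (i < size cs)%N by rewrite -(size_map a).
case: cs ucs csT lt i ni li => // c0 cs ucs csT lt i ni li.
case/negP: ni; apply/codomP; exists (nth c0 (c0 :: cs) i); apply: val_inj.
exact/esym/index_uniq.
Qed.

Lemma cfSeq_perm (s t : seq int) : perm_eq s t -> cfSeq s = cfSeq t.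
Proof.
move=> st; have sz : size s = size t := perm_size st.
have /tuple_permP[p Es] : perm_eq s (in_tuple t) by [].
apply: (@cfColour_rename _ _ _ (fun i => p (cast_ord sz i))) =>
  [i j /perm_inj/cast_ord_inj//|i|i].
  have := congr1 (fun u : seq int => u`_(cast_ord sz i)) Es.
  by rewrite -tnth_nth tnth_mktuple (tnth_nth 0) => /esym.
case/negP; apply/codomP; exists (cast_ord (esym sz) (p^-1%g i)).
by rewrite cast_ordKV permKV.
Qed.

Lemma cfSeq_cons0 s : cfSeq (0 :: s) = cfSeq s.
Proof.
symmetry; apply: (@cfColour_rename _ _ _ (lift ord0)) => [||i ni].
- exact: lift_inj.
- by move=> i; rewrite lift0.
by case: (unliftP ord0 i) ni => [j ->|-> //]; rewrite codom_f.
Qed.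

Lemma cfSeq_neg s : has (fun z => z < 0) s -> cfSeq s = 0.
Proof.
move=> /(has_nthP 0)[i si neg]; apply: cfColour_eq0 => f.
apply/negP=> /has_contentP/(_ (Ordinal si)) /= E.
by move: neg; rewrite -E.
Qed.

Lemma cfSeq_filter0 s : cfSeq (filter (fun z => z != 0) s) = cfSeq s.
Proof.
transitivity (cfSeq (filter (fun z => z != 0) s ++ filter (predC (fun z => z != 0)) s)).
  have : all (fun z => z == 0) (filter (predC (fun z : int => z != 0)) s).
    by apply/allP=> z; rewrite mem_filter /= negbK => /andP[].
  elim: (filter (predC _) s) => [|z u IH]; first by rewrite cats0.
  move=> /= /andP[/eqP-> /IH->]; rewrite -cfSeq_cons0; apply: cfSeq_perm.
  by rewrite -[X in perm_eq X _]/((0 :: filter _ s) ++ u) -cat_rcons perm_cat2r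
    perm_sym perm_rcons.
by apply: cfSeq_perm; rewrite perm_filterC.
Qed.

(** An entry (e, z) stands for z, plus n if e is true: a part n - k of a
    composition remains symbolic, so that one computation covers all large n. *)
Definition entry := (bool * int)%type.
Definition entry_val (e : entry) : int := (if e.1 then n%:Z else 0) + e.2.

Variable g : 'S_n.

(** Formal linear combinations of compositions, read as values of the Young
    permutation characters at g. *)
Definition formal := seq (int * seq entry).
Definition formal_val (F : formal) : algC :=
  \sum_(t <- F) t.1%:~R * cfSeq (map entry_val t.2) g.

Definition scale_formal (c : int) (F : formal) : formal :=
  [seq (c * t.1, t.2) | t <- F].

Lemma formal_val_cat F1 F2 : formal_val (F1 ++ F2) = formal_val F1 + formal_val F2.
Proof. by rewrite /formal_val big_cat. Qed.

Lemma formal_val_scale c F : formal_val (scale_formal c F) = c%:~R * formal_val F.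
Proof.
rewrite /formal_val big_map big_distrr /=; apply: eq_bigr => t _.
by rewrite intrM mulrA.
Qed.

Definition entry_le (e f : entry) : bool :=
  if e.1 == f.1 then e.2 <= f.2 else f.1.

(** From 12 on, all multiplicities in the two decompositions are stable and all
    labels are partitions, so n can stay symbolic; below 12 it is replaced by
    its value, as then parts coincide with n - k or become negative. *)
Definition instantiate (N : nat) (e : entry) : entry :=
  if (N < 12)%N && e.1 then (false, N%:Z + e.2) else e.

Definition normal_term (t : int * seq entry) : int * seq entry :=
  if has (fun e : entry => ~~ e.1 && (e.2 < 0)) t.2 then (0, [::])
  else (t.1, sort entry_le (filter (fun e : entry => e.1 || (e.2 != 0)) t.2)).

(** The coefficients of each composition add up to 0. The fold replaces a big
    sum because it evaluates. *)
Definition vanishes (F : formal) : bool :=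
  all (fun t => foldr (fun u c => if u.2 == t.2 then u.1 + c else c) 0 F == 0) F.

Lemma normal_termP t :
  (normal_term t).1%:~R * cfSeq (map entry_val (normal_term t).2) g =
  t.1%:~R * cfSeq (map entry_val t.2) g.
Proof.
rewrite /normal_term; case: ifP => [neg|_] /=.
  rewrite mul0r [cfSeq (map _ t.2)]cfSeq_neg ?cfunE ?mulr0 //.
  rewrite has_map; apply: sub_has neg => -[[] z] //= zn.
  by rewrite /entry_val /= add0r.
congr (_ * fun_of_cfun _ _).
rewrite (cfSeq_perm (perm_map _ (permEl (perm_sort _ _)))).
rewrite -cfSeq_filter0 -[RHS]cfSeq_filter0 !filter_map -filter_predI;
  congr (cfSeq (map _ _)).
by apply: eq_filter => -[[] z] /=; rewrite ?andbT // /entry_val /= add0r andbb.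
Qed.

Lemma vanishesP F : vanishes F -> formal_val F = 0.
Proof.
move=> /allP vF; pose K := undup (map snd F).
transitivity (\sum_(k <- K) \sum_(t <- F | t.2 == k) t.1%:~R * cfSeq (map entry_val
  k) g).
  rewrite (exchange_big_dep predT) //= /formal_val big_seq [RHS]big_seq.
  apply: eq_bigr => t tF; rewrite -big_filter.
  rewrite (eq_filter (_ : _ =1 pred1 t.2)) => [|k]; last by rewrite /= eq_sym.
  by rewrite filter_pred1_uniq ?undup_uniq ?big_seq1 // mem_undup map_f.
rewrite big_seq big1 // => k; rewrite mem_undup => /mapP[t tF ->].
rewrite -mulr_suml -rmorph_sum /=; have /eqP := vF t tF.
by rewrite -(foldr_map (fun u : int * seq entry => u) (fun u c =>
  if u.2 == t.2 then u.1 + c else c)) map_id => E; rewrite unlock /reducebig E mul0r.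
Qed.

Lemma formal_val_normal F : formal_val (map normal_term F) = formal_val F.
Proof. by rewrite /formal_val big_map; apply: eq_bigr => t _; apply: normal_termP. Qed.

End FormalCharacters.

Section FormalDeterminants.

Variables (n : nat) (g : 'S_n).

(** A permutation is determined by the image of 0 and the permutation that it
    induces on the remaining points. *)
Lemma sum_lift_perm (V : nmodType) r (F : 'S_r.+1 -> V) :
  \sum_w F w = \sum_(j < r.+1) \sum_(w : 'S_r) F (lift_perm ord0 j w).
Proof.
rewrite pair_bigA /=.
pose h (p : 'I_r.+1 * 'S_r) := lift_perm ord0 p.1 p.2.
have hI : injective h.
  move=> [j w] [j' w']; rewrite /h /= => E.
  have Ej : j = j' by rewrite -(lift_perm_id ord0 j w) E lift_perm_id.
  rewrite -Ej in E *; congr pair; apply/permP=> i; apply: (@lift_inj _ j).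
  by rewrite -!(lift_perm_lift ord0) E.
rewrite (reindex h) //; apply/onW_bij/inj_card_bij => //.
by rewrite card_prod card_ord !card_Sn factS.
Qed.

Definition shift_entry (e : entry) (c : nat) : entry := (e.1, e.2 + c%:Z).

Fixpoint expand_det (rows : seq entry) (cols : seq nat) : formal :=
  if rows is e :: rows' then
    flatten [seq [seq ((-1) ^+ j * t.1, shift_entry e (nth 0%N cols j) :: t.2)
                 | t <- expand_det rows' (take j cols ++ drop j.+1 cols)]
            | j <- iota 0 (size cols)]
  else [:: (1, [::])].

(** Laplace expansion along the first row. *)
Lemma expand_detP r rows cols (Phi : seq entry -> algC) :
  size rows = r -> size cols = r ->
  \sum_(t <- expand_det rows cols) t.1%:~R * Phi t.2 =
  \sum_(w : 'S_r) (-1) ^+ w *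
    Phi [seq shift_entry (nth (false, 0) rows i) (nth 0%N cols (w i)) | i :
      'I_r <- enum 'I_r].
Proof.
elim: r rows cols Phi => [|r IH] [|e rows] cols Phi //=.
  move=> _ _; rewrite big_seq1 (big_pred1 1%g) => [|w]; last first.
    by apply/esym/eqP/permP=> -[].
  rewrite odd_perm1 !mul1r; congr (Phi _).
  by apply/esym/size0nil; rewrite size_map size_enum_ord.
move=> [sr] sc; rewrite big_flatten big_map sc -[iota 0 _]/(index_iota 0 r.+1)
  big_mkord.
rewrite sum_lift_perm; apply: eq_bigr => j _.
have sc' : size (take j cols ++ drop j.+1 cols) = r.
  by rewrite size_cat size_drop size_takel sc ?(ltnW (ltn_ord j)) // subSS subnKC //
    -ltnS.
rewrite big_map.
under eq_bigr do rewrite /= intrM -mulrA.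
rewrite -mulr_sumr (IH _ _ (fun s =>
  Phi (shift_entry e (nth 0%N cols j) :: s))) // mulr_sumr.
apply: eq_bigr => w _; rewrite mulrA; congr (_ * Phi _).
  by rewrite odd_lift_perm signr_addb rmorphXn /= rmorphN1 signr_odd.
rewrite enum_ordSl /= lift_perm_id; congr cons; rewrite -map_comp.
apply: eq_map => i; rewrite /= lift_perm_lift; congr shift_entry.
rewrite nth_cat size_takel ?sc ?(ltnW (ltn_ord j)) //.
rewrite /= /bump; case: ltnP => ij; first by rewrite nth_take.
by rewrite nth_drop addSn subnKC // add1n.
Qed.

Definition irr_formal (k : nat) (mu : seq nat) : formal :=
  expand_det ((true, - k%:Z) :: [seq (false, (nth 0%N mu i)%:Z - i.+1%:Z) | i <- iota
    0 (size mu)])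
    (iota 0 (size mu).+1).

Lemma irrS_formal k mu : sorted geq mu -> sumn mu = k -> (k + head 0%N mu <= n)%N ->
  irrS n ((n - k)%N :: mu) g = formal_val g (irr_formal k mu).
Proof.
move=> smu sk kn; rewrite irrS_cfDet.
- rewrite /cfDet sum_cfunE /formal_val /irr_formal.
  rewrite (expand_detP (fun s =>
    cfSeq n (map (entry_val n) s) g) (r := (size mu).+1)) ?size_iota //; last first.
    by rewrite /= size_map size_iota.
  apply: eq_bigr => w _; rewrite cfunE; congr (_ * fun_of_cfun _ _).
  rewrite (@cfColour_enum _ _ _ (enum 'I_(size mu).+1)) ?enum_uniq //;
    last by move=> i; rewrite mem_enum.
  rewrite -map_comp; congr cfSeq; apply: eq_map => i /=.
  rewrite -[0%N :: _]/(iota 0 (size mu).+1) (nth_iota _ _ (ltn_ord (w i))) add0n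
    /entry_val /shift_entry /=.
  case: (unliftP ord0 i) => [j ->|->] /=; last first.
    by rewrite /part /=; lia.
  have jm : (j < size mu)%N by have := ltn_ord j.
  rewrite /bump add0n (nth_map 0%N) ?size_iota // nth_iota // add0n /= /part add0r.
  by rewrite add1n.
- by move: kn; case: (mu) smu => //= a m ->; rewrite andbT /geq /=; lia.
by rewrite /= sk subnK //; lia.
Qed.

End FormalDeterminants.

(** * The two decompositions as formal identities *)

(** A table lists the multiplicity c of the label (n - k) :: mu as (c, k, mu). *)
Definition table := seq (nat * nat * seq nat).

Definition sym_table (n : nat) : table :=
  [:: (1, 0, [::]);
      (delta_ge n 7, 1, [:: 1]);
      (1 + delta_ge n 8, 2, [:: 2]);
      (delta_ge n 7 + delta_ge n 9, 3, [:: 3]);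
      (delta_ge n 7, 3, [:: 2; 1]);
      (delta_ge n 8 + delta_ge n 10, 4, [:: 4]);
      (delta_ge n 8, 4, [:: 3; 1]);
      (1 + delta_ge n 8, 4, [:: 2; 2]);
      (delta_ge n 11, 5, [:: 5]);
      (delta_ge n 9, 5, [:: 4; 1]);
      (delta_ge n 9, 5, [:: 3; 2]);
      (delta_ge n 7, 5, [:: 2; 2; 1]);
      (delta_ge n 12, 6, [:: 6]);
      (delta_ge n 10, 6, [:: 4; 2])]%N.

Definition alt_table (n : nat) : table :=
  [:: (delta_ge n 7, 2, [:: 1; 1]);
      (delta_ge n 8, 3, [:: 2; 1]);
      (1, 3, [:: 1; 1; 1]);
      (delta_ge n 7 + delta_ge n 9, 4, [:: 3; 1]);
      (delta_ge n 7, 4, [:: 2; 1; 1]);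
      (delta_ge n 10, 5, [:: 4; 1]);
      (delta_ge n 8, 5, [:: 3; 2]);
      (delta_ge n 8, 5, [:: 3; 1; 1]);
      (delta_ge n 11, 6, [:: 5; 1]);
      (delta_ge n 9, 6, [:: 3; 3])]%N.

Section FormalIdentity.

Variable n : nat.

Definition table_char (T : table) : 'CF([set: 'S_n]) :=
  \sum_(t <- T) irrS n ((n - t.1.2)%N :: t.2) *+ t.1.1.

(** A label with multiplicity 0 need not be a partition. *)
Definition valid_table (N : nat) (T : table) : bool :=
  all (fun t => (t.1.1 == 0) ||
    [&& sorted geq t.2, sumn t.2 == t.1.2 & t.1.2 + head 0 t.2 <= N])%N T.

Definition table_formal (T : table) : formal :=
  flatten [seq scale_formal t.1.1%:Z (irr_formal t.1.2 t.2) | t <- T].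

Variable g : 'S_n.

Lemma table_formalP N T : (N <= n)%N -> valid_table N T ->
  table_char T g = formal_val g (table_formal T).
Proof.
move=> Nn /allP vT; rewrite /table_char sum_cfunE /table_formal.
pose F t := scale_formal t.1.1%:Z (irr_formal t.1.2 t.2).
have -> : formal_val g (flatten [seq F t | t <- T]) = \sum_(t <- T) formal_val g (F t).
  by rewrite /formal_val big_flatten big_map.
rewrite big_seq [RHS]big_seq; apply: eq_bigr => -[[c k] mu] /vT /= ok.
rewrite /F formal_val_scale; move: ok => /orP[/eqP->|/and3P[smu /eqP sk kN]].
  by rewrite mulr0n cfunE mul0r.
by rewrite muln_cfunE (@irrS_formal _ g k mu) ?(leq_trans kN) // mulr_natl.
Qed.

Definition product_formal (k l : nat) : formal :=
  [seq (1, [:: (true, j%:Z - k%:Z - l%:Z); (false, j%:Z); (false, k%:Z - j%:Z);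
               (false, l%:Z - j%:Z)]) | j <- iota 0 k.+1].

Definition square_formal (k : nat) : formal :=
  flatten [seq
    [seq ((-1) ^+ i,
          [:: (true, j%:Z - (2 * k)%:Z); (false, j%:Z); (false, i%:Z);
              (false, (2 * k)%:Z - (2 * j)%:Z - i%:Z)])
    | i <- iota 0 (2 * k).+1] | j <- iota 0 k.+1].

Lemma product_formalP k l :
  (numfix (subset_content n k) g)%:R * (numfix (subset_content n l) g)%:R =
  formal_val g (product_formal k l).
Proof.
rewrite -natrM numfix_mul natr_sum /formal_val big_map.
rewrite -[iota 0 _]/(index_iota 0 k.+1) big_mkord; apply: eq_bigr => j _.
rewrite -cfColourE mul1r; congr (fun_of_cfun _ _).
rewrite (@cfColour_enum _ _ _ [:: (false, false); (true, true); (true, false);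
  (false, true)]) //; last first.
  by case=> -[] [].
congr cfSeq; rewrite /= /entry_val /=; do !congr cons; by lia.
Qed.

Lemma square_formalP k :
  (numfix (subset_content n k) (g ^+ 2)%g)%:R = formal_val g (square_formal k).
Proof.
rewrite numfix_sqr /formal_val big_flatten big_map.
rewrite -[iota 0 _]/(index_iota 0 k.+1) big_mkord; apply: eq_bigr => j _.
rewrite big_map -[iota 0 _]/(index_iota 0 (2 * k).+1) big_mkord; apply: eq_bigr => i _.
rewrite rmorphXn /= rmorphN1 -cfColourE; congr (_ * fun_of_cfun _ _).
rewrite (@cfColour_enum _ _ _ [:: (false, false); (false, true); (true, true);
  (true, false)]) //; last first.
  by case=> -[] [].
congr cfSeq; rewrite /= /entry_val /=; do !congr cons; by lia.
Qed.

Lemma numfix_subset (h : 'S_n) k :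
  (numfix (subset_content n k) h)%:R = cfSeq n [:: n%:Z - k%:Z; k%:Z] h.
Proof.
rewrite -cfColourE (@cfColour_enum _ _ _ [:: false; true]) //.
by case.
Qed.

Lemma irrS_two_row (h : 'S_n) k : (0 < k)%N -> (2 * k <= n)%N ->
  irrS n [:: n - k; k]%N h =
  (numfix (subset_content n k) h)%:R - (numfix (subset_content n k.-1) h)%:R.
Proof.
move=> k0 kn; rewrite (@irrS_formal _ h k [:: k]) //=; first last.
- by lia.
- by rewrite addn0.
rewrite /formal_val /irr_formal /= !big_cons big_nil /= !numfix_subset.
rewrite /entry_val /shift_entry /= !addr0 !mulr1 expr0 expr1 mulN1r mul1r.
by congr (_ - _); congr (fun_of_cfun (cfSeq n [:: _; _]) h); lia.
Qed.

(** The formal versions of chi ^ 2 + e psi^2(chi) and of twice the table, for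
    chi = [n - 3, 3], the difference of the characters on 3- and 2-subsets. *)
Definition difference_formal (e : int) (T : table) : formal :=
  product_formal 3 3 ++ scale_formal (- 2%:Z) (product_formal 3 2) ++
  product_formal 2 2 ++
  scale_formal e (square_formal 3) ++ scale_formal (- e) (square_formal 2) ++
  scale_formal (- 2%:Z) (table_formal T).

Definition formal_check (e : int) (N : nat) (T : table) : bool :=
  valid_table N T &&
  vanishes [seq normal_term (t.1, map (instantiate N) t.2)
           | t <- difference_formal e T].

Lemma formal_val_instantiate F : let N := minn n 12 in
  formal_val g [seq normal_term (t.1, map (instantiate N) t.2) | t <- F] =
    formal_val g F.
Proof.
move=> N; rewrite (map_comp (fun t => normal_term t) (fun t =>
  (t.1, map (instantiate N) t.2))).
rewrite formal_val_normal /formal_val big_map; apply: eq_bigr => t _ /=.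
rewrite -map_comp; congr (_ * fun_of_cfun (cfSeq _ _) _); apply: eq_map => -[[] z] //=.
  rewrite /instantiate andbT /N /entry_val; case: ltnP => //= lt.
  by rewrite add0r; congr (_%:Z + _); lia.
by rewrite /instantiate andbF.
Qed.

Lemma check_correct (e : int) T : formal_check e (minn n 12) T -> (6 <= n)%N ->
  let chi := irrS n [:: n - 3; 3]%N in
  chi g ^+ 2 + e%:~R * chi (g ^+ 2)%g = 2%:R * table_char T g.
Proof.
move=> /andP[vT /vanishesP] + n6 chi.
move=> /(_ n g); rewrite formal_val_instantiate /difference_formal !formal_val_cat.
rewrite !formal_val_scale -!product_formalP -!square_formalP.
rewrite -(table_formalP (geq_minl n 12) vT) /chi !irrS_two_row //=.
rewrite !rmorphN /= => E.
apply/eqP; rewrite -subr_eq0 -{}E; apply/eqP; ring.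
Qed.

End FormalIdentity.

Lemma check_sym : all (fun N => formal_check 1 N (sym_table N)) (iota 6 7).
Proof. by vm_compute. Qed.

Lemma check_alt : all (fun N => formal_check (-1) N (alt_table N)) (iota 6 7).
Proof. by vm_compute. Qed.

(** * The theorem *)

Lemma delta_ge_minn n m : (m <= 12)%N -> delta_ge (minn n 12) m = delta_ge n m.
Proof. by move=> m12; rewrite /delta_ge leq_min m12 andbT. Qed.

Lemma sym_table_minn n : sym_table (minn n 12) = sym_table n.
Proof. by rewrite /sym_table !delta_ge_minn. Qed.

Lemma alt_table_minn n : alt_table (minn n 12) = alt_table n.
Proof. by rewrite /alt_table !delta_ge_minn. Qed.

Lemma cfS2_table n : (6 <= n)%N ->
  cfS2 (irrS n [:: n - 3; 3]%N) = table_char n (sym_table n).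
Proof.
move=> n6; apply/cfunP=> g; rewrite cfunElock inE mulr1n.
have N6 : minn n 12 \in iota 6 7 by rewrite mem_iota; lia.
have := check_correct g (allP check_sym _ N6) n6;
  rewrite sym_table_minn /= mulr1z mul1r => ->.
by rewrite [2%:R * _]mulrC mulfK // pnatr_eq0.
Qed.

Lemma cfA2_table n : (6 <= n)%N ->
  cfA2 (irrS n [:: n - 3; 3]%N) = table_char n (alt_table n).
Proof.
move=> n6; apply/cfunP=> g; rewrite cfunElock inE mulr1n.
have N6 : minn n 12 \in iota 6 7 by rewrite mem_iota; lia.
have := check_correct g (allP check_alt _ N6) n6;
  rewrite alt_table_minn /= rmorphN1 mulN1r => ->.
by rewrite [2%:R * _]mulrC mulfK // pnatr_eq0.
Qed.

Theorem theorem5p5 (n : nat) (hn : (6 <= n)%N) :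
  cfS2 (irrS n [:: n - 3; 3]%N) =
      irrS n [:: n]%N
    + irrS n [:: n - 1; 1]%N *+ delta_ge n 7
    + irrS n [:: n - 2; 2]%N *+ (1 + delta_ge n 8)
    + irrS n [:: n - 3; 3]%N *+ (delta_ge n 7 + delta_ge n 9)
    + irrS n [:: n - 3; 2; 1]%N *+ delta_ge n 7
    + irrS n [:: n - 4; 4]%N *+ (delta_ge n 8 + delta_ge n 10)
    + irrS n [:: n - 4; 3; 1]%N *+ delta_ge n 8
    + irrS n [:: n - 4; 2; 2]%N *+ (1 + delta_ge n 8)
    + irrS n [:: n - 5; 5]%N *+ delta_ge n 11
    + irrS n [:: n - 5; 4; 1]%N *+ delta_ge n 9
    + irrS n [:: n - 5; 3; 2]%N *+ delta_ge n 9
    + irrS n [:: n - 5; 2; 2; 1]%N *+ delta_ge n 7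
    + irrS n [:: n - 6; 6]%N *+ delta_ge n 12
    + irrS n [:: n - 6; 4; 2]%N *+ delta_ge n 10
  /\
  cfA2 (irrS n [:: n - 3; 3]%N) =
      irrS n [:: n - 2; 1; 1]%N *+ delta_ge n 7
    + irrS n [:: n - 3; 2; 1]%N *+ delta_ge n 8
    + irrS n [:: n - 3; 1; 1; 1]%N
    + irrS n [:: n - 4; 3; 1]%N *+ (delta_ge n 7 + delta_ge n 9)
    + irrS n [:: n - 4; 2; 1; 1]%N *+ delta_ge n 7
    + irrS n [:: n - 5; 4; 1]%N *+ delta_ge n 10
    + irrS n [:: n - 5; 3; 2]%N *+ delta_ge n 8
    + irrS n [:: n - 5; 3; 1; 1]%N *+ delta_ge n 8
    + irrS n [:: n - 6; 5; 1]%N *+ delta_ge n 11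
    + irrS n [:: n - 6; 3; 3]%N *+ delta_ge n 9.
Proof.
rewrite cfS2_table // cfA2_table // /table_char !big_cons !big_nil /=.
by rewrite subn0 !mulr1n !addr0 !addrA.
Qed.
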